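(* Let $\varepsilon>0$. For $1\le n\le N$ let $\varrho_h^n\in Q_h$ with $\varrho_h^n>0$ and $\mathbf u_h^n\in\boldsymbol Q_h$ be a solution of the scheme: for all $0\le n\le N-1$, $K\in\mathcal T_h$, $$\frac{\varrho_{K}^{n+1}-\varrho_{K}^{n}}{\Delta t^n} + \big(\mathrm{div}_h(\varrho_h^{n+1}\mathbf{u}_h^{n+1})\big)_K - \sum_{\sigma\in\mathcal E(K)}\frac{|\sigma|}{|K|}\lambda_{\sigma}[\![\varrho_h^{n+1}]\!]_{\sigma,K} = 0,$$ $$\frac{\varrho_{K}^{n+1}\mathbf u_K^{n+1}-\varrho_{K}^{n}\mathbf u_K^n}{\Delta t^n} + \big(\mathrm{div}_h(\varrho_h^{n}\mathbf{u}_h^{n}\otimes\mathbf u_h^n)\big)_K - \sum_{\sigma\in\mathcal E(K)}\frac{|\sigma|}{|K|}\lambda_{\sigma}[\![\varrho_h^{n+1}\mathbf u_h^{n+1}]\!]_{\sigma,K} +\frac1{\varepsilon^2}\big(\nabla_h p(\varrho_h^{n+1})\big)_K= \mathbf 0,$$ with initial data $\varrho_h^0>0$, $\mathbf u_h^0$ given by cell averages, and with periodic boundary conditions. Suppose that at each time step, for each $\sigma=K|L\in\mathcal E$, $$\lambda_\sigma=\max\left\{1_{[\![\varrho_h^{n+1}]\!]_\sigma\ne0}\,\frac{[\![\varrho_h^{n+1}]\!]_{\sigma}^2\,[\![P''(\varrho_*^{n+1})\mathbf u_h^{n+1}]\!]_\sigma\cdot\mathbf n_\sigma}{4[\![P'(\varrho_h^{n+1})]\!]_\sigma[\![\varrho_h^{n+1}]\!]_\sigma},\right.$$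 $$\left.\ 1_{[\![\mathbf u_h^{n+1}]\!]_\sigma\ne0}\,\frac{-\{\!\{\varrho_h^{n+1}\mathbf u_h^{n+1}\}\!\}_\sigma\cdot\mathbf n_\sigma\,\big[\!\big[\tfrac{|\mathbf u_h^{n+1}|^2}{2}\big]\!\big]_\sigma+[\![\mathbf u_h^{n+1}]\!]_\sigma\cdot\{\!\{\varrho_h^n\mathbf u_h^n\mathbf u_h^n\}\!\}_\sigma\cdot\mathbf n_\sigma}{\{\!\{\varrho_h^{n+1}\}\!\}_\sigma\,\big|[\![\mathbf u_h^{n+1}]\!]_\sigma\big|^2}\right\}.$$ Here $1_{(\cdot)}$ denotes indicators of the corresponding sets of faces (an entry is $0$ where its indicator vanishes). Then for all $0\le n\le N-1$, $$\sum_{K\in\mathcal T_h}|K|\Big(\tfrac12\varrho_K^{n+1}|\mathbf u_K^{n+1}|^2+\tfrac1{\varepsilon^2}P(\varrho_K^{n+1})\Big)\le\sum_{K\in\mathcal T_h}|K|\Big(\tfrac12\varrho_K^{n}|\mathbf u_K^{n}|^2+\tfrac1{\varepsilon^2}P(\varrho_K^{n})\Big).$$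
   Context: Pressure: $p(\varrho)=\kappa\varrho^\gamma$, $P(\varrho)=\frac{\kappa\varrho^\gamma}{\gamma-1}$ with constants $\kappa>0$, $\gamma>1$. Mesh. $d\in\{1,2,3\}$, $\Omega=\mathbb T^d$ (periodic boundary conditions). $\mathcal T_h$ is a finite regular, quasi-uniform mesh of $\Omega$ by compact polygons/polyhedra (intervals if $d=1$); two distinct elements meet in the empty set or in a common face, edge or vertex. $\mathcal E(K)$ is the set of faces of $K$, $\mathcal E$ the set of all faces; by periodicity every face $\sigma=K|L$ is shared by two elements $K,L$. $\mathbf n_{\sigma,K}$ is the unit normal of $\sigma$ pointing out of $K$, so $\mathbf n_{\sigma,K}=-\mathbf n_{\sigma,L}$. $|K|$, $|\sigma|$ are the $d$- and $(d-1)$-dimensional Lebesgue measures. Discrete functions. $Q_h$ is the space of functions constant on each $K\in\mathcal T_h$ (value on $K$ written $\phi_K$), $\boldsymbol Q_h=Q_h^d$. For $\sigma=K|L$: $[\![\phi_h]\!]_{\sigma,K}=\phi_L-\phi_K$, $\{\!\{\phi_h\}\!\}_\sigma=(\phi_K+\phi_L)/2$. Expressions involving $[\![\cdot]\!]_\sigma$ and $\mathbf n_\sigma$ are computed with $[\![\cdot]\!]_{\sigma,K}$ and $\mathbf n_\sigma=\mathbf n_{\sigma,K}$; those used here do not depend on which of the two elements is called $K$. $\{\!\{\varrho\mathbf u\mathbf u\}\!\}_\sigma=\{\!\{\varrho\,\mathbf u\otimes\mathbf u\}\!\}_\sigma$, so $[\![\mathbf v]\!]_\sigma\cdot\{\!\{\varrho\mathbf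 u\mathbf u\}\!\}_\sigma\cdot\mathbf n_\sigma=[\![\mathbf v]\!]_\sigma\cdot\{\!\{\varrho\mathbf u(\mathbf u\cdot\mathbf n_\sigma)\}\!\}_\sigma$. $(\mathrm{div}_h\boldsymbol\varphi_h)_K=\sum_{\sigma\in\mathcal E(K)}\frac{|\sigma|}{|K|}\{\!\{\boldsymbol\varphi_h\}\!\}_\sigma\cdot\mathbf n_{\sigma,K}$ (analogously for tensors), $(\nabla_h\phi_h)_K=\sum_{\sigma\in\mathcal E(K)}\frac{|\sigma|}{|K|}\{\!\{\phi_h\}\!\}_\sigma\mathbf n_{\sigma,K}$. Time. $0=t^0<\dots<t^N=T$, $\Delta t^n=t^{n+1}-t^n$. The coefficients $\lambda_\sigma=\lambda_{\sigma,K}=\lambda_{\sigma,L}\ge0$ may depend on the time step. Initial values: $\varrho_K^0=\frac1{|K|}\int_K\varrho^0\,dx$, $\mathbf u_K^0=\frac1{|K|}\int_K\mathbf u^0\,dx$, with $\varrho^0>0$. Intermediate values. For $\sigma=K|L$ with $[\![\varrho_h^{n+1}]\!]_\sigma\neq0$, $\varrho^{n+1}_{*,K},\varrho^{n+1}_{*,L}$ are points between $\varrho_K^{n+1}$ and $\varrho_L^{n+1}$ such that $$P''(\varrho^{n+1}_{*,L})\tfrac12[\![\varrho_h^{n+1}]\!]_\sigma^2=[\![P(\varrho_h^{n+1})]\!]_{\sigma,K}-P'(\varrho_K^{n+1})[\![\varrho_h^{n+1}]\!]_{\sigma,K},$$ $$P''(\varrho^{n+1}_{*,K})\tfrac12[\![\varrho_h^{n+1}]\!]_\sigma^2=[\![P(\varrho_h^{n+1})]\!]_{\sigma,L}-P'(\varrho_L^{n+1})[\![\varrho_h^{n+1}]\!]_{\sigma,L},$$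 and $[\![P''(\varrho_*^{n+1})\mathbf u_h^{n+1}]\!]_\sigma\cdot\mathbf n_\sigma=\big(P''(\varrho^{n+1}_{*,L})\mathbf u_L^{n+1}-P''(\varrho^{n+1}_{*,K})\mathbf u_K^{n+1}\big)\cdot\mathbf n_{\sigma,K}$. *)

(* Defs.v *)
From HB Require Import structures.
From mathcomp Require Import all_boot all_order all_algebra.
From mathcomp Require Import all_classical all_reals all_analysis.
Import Order.TTheory GRing.Theory Num.Theory numFieldNormedType.Exports.

Set Implicit Arguments.
Unset Strict Implicit.
Unset Printing Implicit Defensive.

Local Open Scope classical_set_scope.
Local Open Scope ring_scope.

Section LebesgueRowVector.
Context {R : realType}.

Section Borel.
Variable d : nat.

Let coor (i : 'I_d) (x : 'rV[R]_d) : R := x ord0 i.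

Let rV_set0 : g_sigma_preimage coor set0.
Proof. exact: sigma_algebra0. Qed.

Let rV_setC A : g_sigma_preimage coor A -> g_sigma_preimage coor (~` A).
Proof. exact: sigma_algebraC. Qed.

Let rV_bigcup (F : _^nat) : (forall i, g_sigma_preimage coor (F i)) ->
  g_sigma_preimage coor (\bigcup_i (F i)).
Proof. exact: sigma_algebra_bigcup. Qed.

HB.instance Definition _ := @isMeasurable.Build default_measure_display
  'rV[R]_d (g_sigma_preimage coor) rV_set0 rV_setC rV_bigcup.

Lemma measurable_coor (i : 'I_d) :
  measurable_fun [set: 'rV[R]_d] (fun x : 'rV[R]_d => x ord0 i).
Proof.
move=> _ Y mY; rewrite setTI; apply: sub_sigma_algebra => /=.
rewrite -bigcup_seq/=; exists i => /=; first by rewrite mem_index_enum.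
by exists Y => //; rewrite setTI.
Qed.

Lemma measurable_fun_coorP d0 (T : measurableType d0) (f : T -> 'rV[R]_d) :
  (forall i, measurable_fun [set: T] (fun x => f x ord0 i)) ->
  measurable_fun [set: T] f.
Proof.
move=> mf _ A mA; rewrite setTI.
suff : g_sigma_preimage (fun i => coor i \o f) `<=` measurable.
  by apply; rewrite g_sigma_preimage_comp; exists A => //; rewrite setTI.
apply: smallest_sub; first exact: sigma_algebra_measurable.
rewrite -bigcup_seq; apply: bigcup_sub => i _ B [C mC <-].
exact: mf.
Qed.

End Borel.

Definition consrV d (p : R * 'rV[R]_d) : 'rV[R]_d.+1 :=
  \row_(i < d.+1) oapp (p.2 ord0) p.1 (unlift ord0 i).

Lemma consrV_inj d : injective (@consrV d).
Proof.
move=> [s x] [t y] /rowP e; have := e ord0; rewrite !mxE unlift_none/= => <-.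
congr pair; apply/rowP => i; have := e (lift ord0 i).
by rewrite !mxE !liftK.
Qed.

Lemma consrV_surj d (x : 'rV[R]_d.+1) :
  consrV (x ord0 ord0, \row_i x ord0 (lift ord0 i)) = x.
Proof.
apply/rowP => i; rewrite !mxE.
by case: unliftP => [j ->|->]/=; rewrite ?mxE.
Qed.

Lemma measurable_consrV d : measurable_fun setT (@consrV d).
Proof.
apply: measurable_fun_coorP => i.
case: (unliftP ord0 i) => [j ->|->].
  rewrite (_ : (fun _ => _) = (fun x : 'rV[R]_d => x ord0 j) \o snd).
    by apply: measurableT_comp => //; exact: measurable_coor.
  by apply/funext => p; rewrite /= !mxE liftK.
rewrite (_ : (fun _ => _) = fst) //.
by apply/funext => p; rewrite /= !mxE unlift_none.
Qed.


Section LebesgueStep.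
Variables (d : nat) (mu : {sigma_finite_measure set 'rV[R]_d -> \bar R}).

Definition lebesgue_consrV : set 'rV[R]_d.+1 -> \bar R :=
  pushforward ((@lebesgue_measure R) \x mu)%E (@consrV d).

Let lebesgue_consrV0 : lebesgue_consrV set0 = 0%E.
Proof. by rewrite /lebesgue_consrV /pushforward preimage_set0 measure0. Qed.

Let lebesgue_consrV_ge0 A : (0 <= lebesgue_consrV A)%E.
Proof. by rewrite /lebesgue_consrV /pushforward measure_ge0. Qed.

Let lebesgue_consrV_sigma_additive : semi_sigma_additive lebesgue_consrV.
Proof.
move=> F mF tF mUF; rewrite /lebesgue_consrV /pushforward preimage_bigcup.
have mpre A : measurable A -> measurable (@consrV d @^-1` A).
  by move=> mA; rewrite -[X in measurable X]setTI; exact: measurable_consrV.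
apply: measure_semi_sigma_additive.
- by move=> n; exact: mpre.
- apply/trivIsetP => /= i j _ _ ij; rewrite -preimage_setI.
  by move/trivIsetP : tF => /(_ _ _ _ _ ij) ->//; rewrite preimage_set0.
- by rewrite -preimage_bigcup; exact: mpre.
Qed.

HB.instance Definition _ := isMeasure.Build _ _ _ lebesgue_consrV
  lebesgue_consrV0 lebesgue_consrV_ge0 lebesgue_consrV_sigma_additive.

Let lebesgue_consrV_sigma_finite : sigma_finite setT lebesgue_consrV.
Proof.
pose g (x : 'rV[R]_d.+1) : measurableTypeR R * 'rV[R]_d :=
  (x ord0 ord0, \row_i x ord0 (lift ord0 i)).
have gK : cancel (@consrV d) g.
  by move=> p; apply: consrV_inj; rewrite consrV_surj.
have mg : measurable_fun setT g.
  apply/measurable_fun_pairP; split; first exact: measurable_coor.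
  apply: measurable_fun_coorP => i.
  rewrite (_ : (fun _ => _) = fun x : 'rV[R]_d.+1 => x ord0 (lift ord0 i)).
    exact: measurable_coor.
  by apply/funext => x /=; rewrite mxE.
have /sigma_finiteP[F [TF ndF Foo]] := sigma_finiteT (@lebesgue_measure R).
have /sigma_finiteP[G [TG ndG Goo]] := sigma_finiteT mu.
have mFG n : measurable (F n `*` G n).
  by apply: measurableX; [have [] := Foo n|have [] := Goo n].
exists (fun n => g @^-1` (F n `*` G n)).
  rewrite -preimage_bigcup; apply/seteqP; split => // x _.
  have : setT (g x).1 by [].
  have : setT (g x).2 by [].
  rewrite TF TG => -[k _ Gk] [n _ Fn]; exists (maxn n k) => //; split.
  - by move: Fn; exact/subsetPset/ndF/leq_maxl.
  - by move: Gk; exact/subsetPset/ndG/leq_maxr.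
move=> n; have [[mFn Fn] [mGn Gn]] := (Foo n, Goo n); split.
  by rewrite -[X in measurable X]setTI; exact: mg.
rewrite /lebesgue_consrV /pushforward (_ : _ @^-1` _ = F n `*` G n).
  by rewrite product_measure1E// lte_mul_pinfty// ge0_fin_numE.
by apply/seteqP; split => p; rewrite /preimage /mkset gK.
Qed.

HB.instance Definition _ := Measure_isSigmaFinite.Build _ _ _
  lebesgue_consrV lebesgue_consrV_sigma_finite.
End LebesgueStep.

Fixpoint leb (d : nat) : {sigma_finite_measure set 'rV[R]_d -> \bar R} :=
  if d is d'.+1 then lebesgue_consrV (leb d') else \d_(0 : 'rV[R]_0).

End LebesgueRowVector.

Arguments leb {R} d.

Section Geometry.
Context {R : realType}.

Definition dotv d (u v : 'rV[R]_d) : R := \sum_i u ord0 i * v ord0 i.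

Definition latticeV d (z : 'rV[int]_d) : 'rV[R]_d := map_mx intr z.

Definition translate d (z : 'rV[int]_d) (A : set 'rV[R]_d) : set 'rV[R]_d :=
  [set x + latticeV z | x in A].

(* Subsets of the torus R^d / Z^d are handled as Z^d-invariant subsets of R^d:
   [periodize A] is the preimage in R^d of the image of A in the torus. *)
Definition periodize d (A : set 'rV[R]_d) : set 'rV[R]_d :=
  \bigcup_z translate z A.

Definition lattice_periodic d (V : Type) (f : 'rV[R]_d -> V) :=
  forall x z, f (x + latticeV z) = f x.

Definition unit_cube d : set 'rV[R]_d :=
  [set x | forall i, 0 <= x ord0 i < 1].

Definition solid k (A : set 'rV[R]_k) :=
  [/\ compact A, closure A° = A, A° !=set0 & connected A°].

(* A [cell] is a solid compact subset of a [cell_dim]-dimensional affine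
   subspace of R^d, given through an isometric parametrization of that subspace
   by R^cell_dim: the rows of [cell_frame] are orthonormal. The condition that
   its relative boundary is a finite union of cells of one dimension less, which
   makes it a polytope (segment, polygon, polyhedron; not necessarily convex),
   is imposed in [mesh]. *)
Record cell (d : nat) := Cell {
  cell_dim : nat;
  cell_base : 'rV[R]_d;
  cell_frame : 'M[R]_(cell_dim, d);
  cell_dom : set 'rV[R]_cell_dim;
  cell_frame_orthonormal : cell_frame *m cell_frame^T = 1%:M;
  cell_dom_solid : solid cell_dom
}.

Arguments cell_dim {d} c.
Arguments cell_base {d} c.
Arguments cell_frame {d} c.
Arguments cell_dom {d} c.

Section CellSets.
Variables (d : nat) (c : cell d).

Definition cell_chart (y : 'rV[R]_(cell_dim c)) : 'rV[R]_d :=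
  cell_base c + y *m cell_frame c.

Definition cell_set := cell_chart @` cell_dom c.
Definition cell_relint := cell_chart @` (cell_dom c)°.
Definition cell_relbd := cell_chart @` (cell_dom c `\` (cell_dom c)°).

(* [cell_dim c]-dimensional Lebesgue measure of [cell_set]; it is 1 for a
   vertex. *)
Definition cell_measure : R := fine (leb (cell_dim c) (cell_dom c)).

End CellSets.

(* A mesh of the torus R^d / Z^d. An element is a polyhedron of R^d on which the
   projection to the torus is injective; [subcell] enumerates the faces (cells
   of dimension d - 1), edges and vertices of the mesh, up to lattice
   translations: the copy of the face s which lies on the boundary of the
   element K is [translate (elt_shift K s) (cell_set (cell_of s))], and
   similarly for [cell_shift]. *)
Record mesh (d : nat) := Mesh {
  elt : finType;
  subcell : finType;
  elt_set : elt -> set 'rV[R]_d;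
  cell_of : subcell -> cell d;
  elt_faces : elt -> {set subcell};
  cell_faces : subcell -> {set subcell};
  elt_shift : elt -> subcell -> 'rV[int]_d;
  cell_shift : subcell -> subcell -> 'rV[int]_d;
  face_normal : subcell -> elt -> 'rV[R]_d;

  elt_set_solid : forall K, solid (elt_set K);
  elt_set_embedded : forall K x z,
    elt_set K x -> elt_set K (x + latticeV z) -> z = 0;
  elt_set_cover : \bigcup_K periodize (elt_set K) = setT;

  elt_faces_dim : forall K s,
    s \in elt_faces K -> (cell_dim (cell_of s)).+1 = d;
  elt_set_boundary : forall K,
    elt_set K `\` (elt_set K)° =
    \bigcup_(s in [set` elt_faces K])
      translate (elt_shift K s) (cell_set (cell_of s));
  elt_faces_disjoint : forall K s s',
    s \in elt_faces K -> s' \in elt_faces K -> s != s' ->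
    translate (elt_shift K s) (cell_relint (cell_of s)) `&`
    translate (elt_shift K s') (cell_relint (cell_of s')) = set0;

  cell_faces_dim : forall c c', c' \in cell_faces c ->
    (cell_dim (cell_of c')).+1 = cell_dim (cell_of c);
  cell_boundary : forall c,
    cell_relbd (cell_of c) =
    \bigcup_(c' in [set` cell_faces c])
      translate (cell_shift c c') (cell_set (cell_of c'));
  cell_faces_disjoint : forall c c' c'',
    c' \in cell_faces c -> c'' \in cell_faces c -> c' != c'' ->
    translate (cell_shift c c') (cell_relint (cell_of c')) `&`
    translate (cell_shift c c'') (cell_relint (cell_of c'')) = set0;

  (* [connect] from a face of K reaches the faces, edges and vertices of K *)
  elt_conforming : forall K L, K != L ->
    let subcells_of J := [set c : subcell | [exists s in elt_faces J,
      connect (fun a b => b \in cell_faces a) s c]]%SET in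
    periodize (elt_set K) `&` periodize (elt_set L) = set0 \/
    exists2 c, c \in (subcells_of K :&: subcells_of L)%SET &
      periodize (elt_set K) `&` periodize (elt_set L) =
      periodize (cell_set (cell_of c));

  face_shared : forall s, (cell_dim (cell_of s)).+1 = d ->
    #|[set K | s \in elt_faces K]%SET| = 2%N;

  face_normal_unit : forall K s, s \in elt_faces K ->
    dotv (face_normal s K) (face_normal s K) = 1;
  face_normal_orthogonal : forall K s, s \in elt_faces K ->
    cell_frame (cell_of s) *m (face_normal s K)^T = 0;
  face_normal_outward : forall K s x, s \in elt_faces K ->
    translate (elt_shift K s) (cell_relint (cell_of s)) x ->
    \forall t \near 0^'+,
      elt_set K (x - t *: face_normal s K) /\
      ~ elt_set K (x + t *: face_normal s K);
  face_normal_opp : forall K L s, s \in elt_faces K -> s \in elt_faces L ->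
    K != L -> face_normal s K = - face_normal s L
}.

End Geometry.

Arguments unit_cube {R} d.

Section Discrete.
Context {R : realType} {d : nat}.
Variable M : mesh (R := R) d.

Implicit Types (K L : elt M) (s : subcell M).

(* Shape regularity and quasi-uniformity with mesh size h and constant theta;
   the balls are Euclidean. *)
Definition regular_quasi_uniform (h theta : R) :=
  forall K,
    (forall x y, elt_set K x -> elt_set K y ->
      dotv (x - y) (x - y) <= h ^+ 2) /\
    (exists a, forall x,
      dotv (x - a) (x - a) <= (theta * h) ^+ 2 -> elt_set K x).

Definition vol K : R := fine (leb d (elt_set K)).
Definition area s : R := cell_measure (cell_of s).

(* The element L such that s = K|L. *)
Definition nbr s K : elt M :=
  odflt K [pick L | (L != K) && (s \in elt_faces L)].

Definition jump (V : zmodType) (phi : elt M -> V) s K : V :=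
  phi (nbr s K) - phi K.

Definition mean (V : lmodType R) (phi : elt M -> V) s K : V :=
  2^-1 *: (phi K + phi (nbr s K)).

Definition meanR (phi : elt M -> R) s K : R := mean (phi : elt M -> R^o) s K.

(* T n, as a row vector. *)
Definition tensor_apply (T : 'M[R]_d) (n : 'rV[R]_d) : 'rV[R]_d := n *m T^T.

Definition tensor (v w : 'rV[R]_d) : 'M[R]_d := v^T *m w.

Definition divh (phi : elt M -> 'rV[R]_d) K : R :=
  \sum_(s in elt_faces K)
    area s / vol K * dotv (mean phi s K) (face_normal s K).

Definition divhT (phi : elt M -> 'M[R]_d) K : 'rV[R]_d :=
  \sum_(s in elt_faces K)
    (area s / vol K) *: tensor_apply (mean phi s K) (face_normal s K).

Definition gradh (phi : elt M -> R) K : 'rV[R]_d :=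
  \sum_(s in elt_faces K)
    (area s / vol K * meanR phi s K) *: face_normal s K.

Definition cell_average (f : 'rV[R]_d -> R) K : R :=
  (\int[leb d]_(x in elt_set K) f x) / vol K.

Definition cell_averageV (f : 'rV[R]_d -> 'rV[R]_d) K : 'rV[R]_d :=
  \row_i cell_average (fun x => f x ord0 i) K.

End Discrete.

Section Scheme.
Context {R : realType} {d : nat}.
Variable M : mesh (R := R) d.
Variables kappa gamma eps : R.

Implicit Types (K L : elt M) (s : subcell M).
Implicit Types (rho : elt M -> R) (u : elt M -> 'rV[R]_d).

Definition pressure (r : R) : R := kappa * r `^ gamma.
Definition potential (r : R) : R := kappa * r `^ gamma / (gamma - 1).

Local Notation P := potential.
Local Notation P' := (derive1 potential).
Local Notation P'' := (derive1n 2 potential).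

Definition momentum rho u : elt M -> 'rV[R]_d := fun K => rho K *: u K.

Definition momentum_flux rho u : elt M -> 'M[R]_d :=
  fun K => rho K *: tensor (u K) (u K).

Definition kinetic u : elt M -> R := fun K => dotv (u K) (u K) / 2.

(* One time step, from (rho, u) to (rho1, u1), with numerical diffusion
   coefficients lam. *)
Definition mass_equation (dt : R) (lam : subcell M -> R) rho rho1 u1 :=
  forall K,
    (rho1 K - rho K) / dt + divh (momentum rho1 u1) K
    - \sum_(s in elt_faces K) area s / vol K * lam s * jump rho1 s K = 0.

Definition momentum_equation (dt : R) (lam : subcell M -> R) rho u rho1 u1 :=
  forall K,
    dt^-1 *: (momentum rho1 u1 K - momentum rho u K)
    + divhT (momentum_flux rho u) K
    - \sum_(s in elt_faces K)
        (area s / vol K * lam s) *: jump (momentum rho1 u1) s K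
    + (eps ^+ 2)^-1 *: gradh (pressure \o rho1) K = 0.

(* [rs s K] is the value at the side K of the face s. The second of the two
   equations defining these values is the first one with K and L exchanged. *)
Definition intermediate_values (rs : subcell M -> elt M -> R) rho1 :=
  forall s K, s \in elt_faces K -> jump rho1 s K != 0 ->
    let L := nbr s K in
    Num.min (rho1 K) (rho1 L) <= rs s L <= Num.max (rho1 K) (rho1 L) /\
    P'' (rs s L) * (2^-1 * jump rho1 s K ^+ 2) =
      jump (P \o rho1) s K - P' (rho1 K) * jump rho1 s K.

Definition lam_pressure (rs : subcell M -> elt M -> R) rho1 u1 s K : R :=
  if jump rho1 s K == 0 then 0 else
    let L := nbr s K in
    jump rho1 s K ^+ 2 *
    dotv (P'' (rs s L) *: u1 L - P'' (rs s K) *: u1 K) (face_normal s K)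
    / (4 * jump (P' \o rho1) s K * jump rho1 s K).

Definition lam_convection rho u rho1 u1 s K : R :=
  if jump u1 s K == 0 then 0 else
    (- dotv (mean (momentum rho1 u1) s K) (face_normal s K)
       * jump (kinetic u1) s K
     + dotv (jump u1 s K)
         (tensor_apply (mean (momentum_flux rho u) s K) (face_normal s K)))
    / (meanR rho1 s K * dotv (jump u1 s K) (jump u1 s K)).

Definition lam_condition (rs : subcell M -> elt M -> R) (lam : subcell M -> R)
    rho u rho1 u1 :=
  forall s K, s \in elt_faces K ->
    lam s = Num.max (lam_pressure rs rho1 u1 s K)
                    (lam_convection rho u rho1 u1 s K).

Definition energy rho u : R :=
  \sum_(K : elt M)
    vol K * (2^-1 * rho K * dotv (u K) (u K) + (eps ^+ 2)^-1 * P (rho K)).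

End Scheme.

(* Main.v *)
Require Import Defs.
From mathcomp Require Import all_boot all_order all_algebra.
From mathcomp Require Import all_classical all_reals all_analysis.
From mathcomp Require Import measurable_realfun ring lra.
Import Order.TTheory GRing.Theory Num.Theory numFieldNormedType.Exports.

Set Implicit Arguments.
Unset Strict Implicit.
Unset Printing Implicit Defensive.

Local Open Scope classical_set_scope.
Local Open Scope ring_scope.

(** The energy inequality is a discrete version of the formal computation for
the Euler equations: test the momentum equation of the element K with the new
velocity u_K, the mass equation with P'(rho_K)/eps^2 - |u_K|^2/2, multiply by
|K| and add over all K.

The time differences give at least the difference of the two energies:
convexity of P handles the internal energy, and the kinetic part leaves the
remainder rho^n |u^{n+1} - u^n|^2 / 2 >= 0 (here rho^n > 0 is used).  It
remains to see that the tested fluxes have the right sign.  They form a sum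
over pairs (face s, element K) which is regrouped face by face with the help
of the involution K |-> nbr s K ([sum_faces_le0]).  On one face the convective
terms add up to the numerator of the second entry of lambda minus
lambda {rho} |[u]|^2 ([convective_face_dissipation]).  The pressure terms
combine, since p = rho P' - P, to [p u].n plus
[rho]^2 [P''(rho_star) u].n / 4 minus lambda [P'][rho]
([pressure_face_dissipation]); the intermediate values are made to absorb the
two second order Taylor remainders of P.  The choice of lambda makes both
contributions nonpositive, except for [p u].n.

That last term is not local to a face.  Summed over the mesh it vanishes
because every element K is a closed polyhedron: the area vectors
|s| n_{s,K} of its faces add up to 0 ([sum_area_normal]).  This is the
divergence theorem for constant fields, and a mesh element is only known to be
a solid compact set whose boundary is a union of isometrically parametrized
flat cells, so it has to be derived from that description.  Fix a coordinate
direction e_i and look at the lines parallel to it.  Almost every line meets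
the boundary of K only in relative interiors of faces that are transversal to
e_i.  Following such a line from -oo to +oo it enters and leaves K alternately,
so the signs of the components n_i at its crossings cancel
([line_crossings]).  Integrating this cancellation over all lines yields
sum_s sgn(n_i) |proj_i s| = 0, where proj_i forgets the coordinate i, and
|proj_i s| = |n_i| |s| ([leb_proj]) by the linear change of variables formula
for Lebesgue measure ([leb_affine]), because the minor of an orthonormal frame
that omits column i has determinant +-n_i ([det_projected_frame]). *)

(** * Row vectors: continuity, Borel sets and slices of Lebesgue measure *)

Section Measure.
Context {R : realType}.

Lemma cvg_rV (T : Type) (F : set_system T) (FF : Filter F) d
    (f : T -> 'rV[R]_d) (l : 'rV[R]_d) :
  (forall i, f x ord0 i @[x --> F] --> l ord0 i) -> f x @[x --> F] --> l.
Proof.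
move=> fl A [P lP PA].
have : \forall x \near F, forall i, P ord0 i (f x ord0 i).
  by apply: filter_forall => i; exact: (fl i _ (lP ord0 i)).
by apply: filterS => x Px; apply: PA => i j; rewrite ord1.
Qed.

Lemma continuous_affine_rV m n (b : 'rV[R]_n) (A : 'M[R]_(m, n)) :
  continuous (fun x : 'rV[R]_m => b + x *m A).
Proof.
move=> x; apply: (@cvg_rV _ (nbhs x)) => i /=; rewrite !mxE.
under eq_fun do rewrite !mxE.
apply: cvgD; first exact: cvg_cst.
apply: cvg_big => //= [|j _]; first exact: add_continuous.
by apply: cvgM; [exact: coord_continuous|exact: cvg_cst].
Qed.

Lemma measurable_affine_rV m n (b : 'rV[R]_n) (A : 'M[R]_(m, n)) :
  measurable_fun setT (fun x : 'rV[R]_m => b + x *m A).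
Proof.
apply: measurable_fun_coorP => i.
under eq_fun do rewrite !mxE.
apply: measurable_funD => //; apply: measurable_sum => j.
by apply: measurable_funM => //; exact: measurable_coor.
Qed.

(** The sigma-algebra on row vectors is generated by the coordinates, so it has
to be compared with the topology: an open set is the union of the countably
many boxes with rational centre and radius 1/(k+1) that it contains. *)
Lemma open_measurable_rV d (U : set 'rV[R]_d) : open U -> measurable U.
Proof.
move=> oU.
pose box (p : 'rV[rat]_d * nat) : set 'rV[R]_d :=
  [set x | forall i, ball (ratr (p.1 ord0 i) : R) p.2.+1%:R^-1 (x ord0 i)].
pose F p := if pselect (box p `<=` U) then box p else set0.
have mbox p : measurable (box p).
  rewrite (_ : box p = \bigcap_(i in setT)
      ((fun x : 'rV[R]_d => x ord0 i) @^-1`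
        ball (ratr (p.1 ord0 i) : R) p.2.+1%:R^-1)).
    apply: fin_bigcap_measurable; first exact: finite_finset.
    move=> i _; rewrite -[X in measurable X]setTI.
    by apply: measurable_coor => //; exact: measurable_ball.
  by apply/seteqP; split => [x bx i _|x bx i]; [exact: bx|exact: (bx i I)].
suff -> : U = \bigcup_p F p.
  apply: countable_bigcupT_measurable; first exact: countableP.
  move=> p; rewrite /F; case: pselect => [pU|nU]; first exact: mbox.
  exact: measurable0.
apply/seteqP; split => [x Ux|x [p _]]; last first.
  by rewrite /F; case: pselect => // pU; exact: pU.
have /nbhs_ballP[e /= e0 eU] : nbhs x U by exact: open_nbhs_nbhs.
have [n ne] : exists n, n.+1%:R^-1 < e / 2 :> R.
  have [n _ nP] := near_infty_natSinv_lt (PosNum (divr_gt0 e0 (ltr0Sn _ 1))).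
  by exists n; apply: nP => /=.
have q_ex i : exists q : rat, ball (ratr q : R) n.+1%:R^-1 (x ord0 i).
  have := @rat_in_itvoo R (x ord0 i - n.+1%:R^-1) (x ord0 i + n.+1%:R^-1).
  case=> [|q]; first by rewrite ltrD2l gt0_cp.
  by rewrite in_itv/= => qx; exists q; rewrite -ball_normE/= distrC ltr_distlC.
have [q qP] := choice q_ex.
exists (\row_i q i, n) => //; rewrite /F; case: pselect => [_ i|nU]/=.
  by rewrite mxE.
exfalso; apply: nU => y /= yq; apply: eU; split => // i j; rewrite ord1.
have := yq j; have := qP j; rewrite mxE -!ball_normE /= => a b.
apply: le_lt_trans (ler_distD (ratr (q j)) _ _) _.
rewrite distrC in a; apply: lt_le_trans (ltrD a b) _.
by rewrite [leRHS]splitr ltW ?ltrD.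
Qed.

Lemma closed_measurable_rV d (U : set 'rV[R]_d) : closed U -> measurable U.
Proof.
move=> cU; rewrite -(setCK U); apply: measurableC.
by apply: open_measurable_rV; apply: closed_openC.
Qed.

Lemma compact_measurable_rV d (U : set 'rV[R]_d) : compact U -> measurable U.
Proof.
move=> cU; apply: closed_measurable_rV; apply: compact_closed cU.
exact: (@norm_hausdorff _ 'rV[R]_d).
Qed.

(** [leb] is an iterated product, so it can be computed by fixing the first
coordinate ([_head]) or, by Tonelli, all the others ([_tail]). *)
Lemma leb_slice_head d (S : set 'rV[R]_d.+1) :
  leb d.+1 S = (\int[lebesgue_measure]_t leb d [set x | S (consrV (t, x))])%E.
Proof.
apply: eq_integral => t _ /=; congr (leb d _).
by apply/seteqP; split => x; rewrite /xsection/= inE.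
Qed.

Lemma measurable_preimage_consrV d (S : set 'rV[R]_d.+1) :
  measurable S -> measurable (@consrV R d @^-1` S).
Proof.
by move=> mS; rewrite -[X in measurable X]setTI; exact: measurable_consrV.
Qed.

Lemma leb_slice_tail d (S : set 'rV[R]_d.+1) : measurable S ->
  leb d.+1 S = (\int[leb d]_x lebesgue_measure [set t : R | S (consrV (t, x))])%E.
Proof.
move=> mS.
transitivity ((@lebesgue_measure R \x^ leb d) (@consrV R d @^-1` S))%E.
  apply: (@product_measure_unique _ _ _ _ _ _ _ (@lebesgue_measure R \x^ leb d)%E).
    by move=> A B mA mB; rewrite /= product_measure2E.
  exact: measurable_preimage_consrV.
apply: eq_integral => t _ /=; congr lebesgue_measure.
by apply/seteqP; split => x; rewrite /ysection/= inE.
Qed.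

Lemma measurable_slice_head d (S : set 'rV[R]_d.+1) (t : R) :
  measurable S -> measurable [set x : 'rV[R]_d | S (consrV (t, x))].
Proof.
move=> /measurable_preimage_consrV/(measurable_xsection t).
by congr measurable; apply/seteqP; split => x; rewrite /xsection/= inE.
Qed.

Lemma measurable_slice_tail d (S : set 'rV[R]_d.+1) (x : 'rV[R]_d) :
  measurable S -> measurable [set t : R | S (consrV (t, x))].
Proof.
move=> /measurable_preimage_consrV/(measurable_ysection x).
by congr measurable; apply/seteqP; split => y; rewrite /ysection/= inE.
Qed.

End Measure.

(** * Affine change of variables *)

Section Affine.
Context {R : realType}.

(** Both sides are measures in S, so it suffices to compare half-open
intervals. *)
Lemma lebesgue_measure_affine (a b : R) (S : set R) : a != 0 -> measurable S ->
  lebesgue_measure S =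
  (`|a|%:E * lebesgue_measure [set t : R | S (b + a * t)%R])%E.
Proof.
move=> a0 mS.
have mf : measurable_fun setT ((fun t => b + a * t) : R -> measurableTypeR R).
  by apply: measurable_funD => //; exact: measurable_funM.
have a_ge0 : 0 <= `|a| by [].
pose mu :=
  measure_function_pushforward__canonical__measure_function_Measure
    (@lebesgue_measure R) mf.
transitivity (mscale (NngNum a_ge0) mu S); last by [].
apply: lebesgue_measure_unique => // _ [[x y]] _ <-.
transitivity (`|a|%:E *
  lebesgue_measure ((fun t : R => b + a * t)%R @^-1` `]x, y] : set R))%E; last by [].
have -> : (fun t => b + a * t) @^-1` `]x, y] =
  if 0 < a then `](x - b) / a, (y - b) / a]%classic
           else `[(y - b) / a, (x - b) / a[%classic.
  case: ltP => [a_gt0|a_le0]; apply/seteqP; split => t; rewrite /= !in_itv/=.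
  - by rewrite ltr_pdivrMr// ler_pdivlMr// ltrBlDl lerBrDl mulrC.
  - by rewrite ltr_pdivrMr// ler_pdivlMr// ltrBlDl lerBrDl mulrC.
  - have {}a_le0 : a < 0 by rewrite lt_neqAle a0.
    by rewrite ltr_ndivlMr// ler_ndivrMr// ltrBlDl lerBrDl mulrC andbC.
  - have {}a_le0 : a < 0 by rewrite lt_neqAle a0.
    by rewrite ltr_ndivlMr// ler_ndivrMr// ltrBlDl lerBrDl mulrC andbC.
have E : (`|a| * (`|a|^-1 * (y - x)) = y - x)%R.
  by rewrite mulrA mulfV ?mul1r ?normr_eq0.
case: ltP => [a_gt0|a_le0]; rewrite !lebesgue_measure_itv/= !lte_fin.
- rewrite ltr_pM2r ?invr_gt0// ltrD2r; case: ifP => _; last by rewrite mule0.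
  by rewrite -!EFinB -EFinM -E gtr0_norm//; congr (_%:E); ring.
- have {}a_le0 : a < 0 by rewrite lt_neqAle a0.
  rewrite ltr_nM2r ?invr_lt0// ltrD2r; case: ifP => _; last by rewrite mule0.
  by rewrite -!EFinB -EFinM -E ltr0_norm// invrN; congr (_%:E); ring.
Qed.

Lemma consrVE m (p : R * 'rV[R]_m) :
  consrV p = row_mx (p.1%:M : 'M[R]_1) p.2 :> 'rV[R]_(1 + m).
Proof.
apply/rowP => i; rewrite !mxE; case: splitP => j ij.
  rewrite [j]ord1 in ij *; rewrite (_ : i = ord0) ?unlift_none/=; last exact/val_inj.
  by rewrite mxE eqxx.
by rewrite (_ : i = lift ord0 j) ?liftK//; apply/val_inj.
Qed.

End Affine.

Section ChangeOfVariables.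
Context {R : realType}.

(** The map f multiplies volumes by k.  Using preimages, no measurability of
images is required and composition is immediate. *)
Definition scales_leb m (k : R) (f : 'rV[R]_m -> 'rV[R]_m) :=
  forall S, measurable S -> leb m S = (k%:E * leb m (f @^-1` S))%E.

Lemma scales_leb_comp m (k l : R) (f g : 'rV[R]_m -> 'rV[R]_m) :
  measurable_fun setT g ->
  scales_leb k f -> scales_leb l g -> scales_leb (l * k) (g \o f).
Proof.
move=> mg hf hg S mS; rewrite hg// hf ?muleA ?EFinM//.
by rewrite -[X in measurable X]setTI; exact: mg.
Qed.

Lemma measurable_leb_slice_head m (S : set 'rV[R]_m.+1) : measurable S ->
  measurable_fun setT (fun t : R => leb m [set x | S (consrV (t, x))]).
Proof.
move=> /measurable_preimage_consrV/(measurable_fun_xsection (leb m)).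
by congr measurable_fun; apply/funext => t /=; congr (leb m _);
  apply/seteqP; split => x; rewrite /xsection/= inE.
Qed.

Lemma measurable_leb_slice_tail m (S : set 'rV[R]_m.+1) : measurable S ->
  measurable_fun setT (fun x => lebesgue_measure [set t : R | S (consrV (t, x))]).
Proof.
move=> /measurable_preimage_consrV/(measurable_fun_ysection (@lebesgue_measure R)).
by congr measurable_fun; apply/funext => t /=; congr lebesgue_measure;
  apply/seteqP; split => x; rewrite /ysection/= inE.
Qed.

Lemma measurable_preimage_affine m n (b : 'rV[R]_n) (A : 'M[R]_(m, n)) S :
  measurable S -> measurable ((fun x : 'rV[R]_m => b + x *m A) @^-1` S).
Proof.
by move=> mS; rewrite -[X in measurable X]setTI; exact: measurable_affine_rV.
Qed.

(** When all coordinates but the first are fixed, a block lower triangular map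
acts on the first one by t |-> (b + x c) + a t. *)
Lemma scales_leb_lower m (a b : R) (c : 'cV[R]_m) : a != 0 ->
  scales_leb `|a| (fun x : 'rV[R]_(1 + m) =>
    row_mx b%:M 0 + x *m block_mx a%:M 0 c 1%:M).
Proof.
move=> a0 S mS.
have mS' := measurable_preimage_affine (row_mx b%:M 0) (block_mx a%:M 0 c 1%:M) mS.
rewrite [in LHS](@leb_slice_tail _ m)// [in RHS](@leb_slice_tail _ m)//.
rewrite -ge0_integralZl//; last exact: measurable_leb_slice_tail.
apply: eq_integral => x _.
rewrite (@lebesgue_measure_affine _ a (b + (x *m c) ord0 ord0))//; last first.
  exact: measurable_slice_tail.
congr (_ * lebesgue_measure _)%E; apply/seteqP.
suff E t : consrV (b + (x *m c) ord0 ord0 + a * t, x) =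
    row_mx b%:M 0 + (consrV (t, x) : 'rV[R]_(1 + m)) *m block_mx a%:M 0 c 1%:M.
  by split => t /=; rewrite E.
rewrite !consrVE /= mul_row_block add_row_mx mulmx0 mulmx1 !add0r.
rewrite (_ : (_ + _ + _)%:M = b%:M + (t%:M *m a%:M + x *m c) :> 'M[R]_1)//.
by apply/rowP => i; rewrite !ord1 -scalar_mxM !mxE !mulr1n; ring.
Qed.

(** When the first coordinate t is fixed, a block upper triangular map acts on
the others by the affine map x |-> (b + t r) + x B. *)
Lemma scales_leb_upper m (b r : 'rV[R]_m) (B : 'M[R]_m) :
  (forall b', scales_leb `|\det B| (fun x : 'rV[R]_m => b' + x *m B)) ->
  scales_leb `|\det B| (fun x : 'rV[R]_(1 + m) =>
    row_mx 0 b + x *m block_mx 1%:M r 0 B).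
Proof.
move=> hB S mS.
have mS' := measurable_preimage_affine (row_mx 0 b) (block_mx 1%:M r 0 B) mS.
rewrite [in LHS](@leb_slice_head _ m)// [in RHS](@leb_slice_head _ m)//.
rewrite -ge0_integralZl//; last exact: measurable_leb_slice_head.
apply: eq_integral => t _.
rewrite (hB (b + t *: r)); last exact: measurable_slice_head.
congr (_ * leb m _)%E; apply/seteqP.
suff E x : consrV (t, b + t *: r + x *m B) =
    row_mx 0 b + (consrV (t, x) : 'rV[R]_(1 + m)) *m block_mx 1%:M r 0 B.
  by split => x /=; rewrite E.
rewrite !consrVE /= mul_row_block add_row_mx mulmx0 mulmx1 !add0r addr0.
by rewrite mul_scalar_mx addrA.
Qed.

Lemma ulsubmx00 m (A : 'M[R]_(1 + m)) : ulsubmx A ord0 ord0 = A ord0 ord0.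
Proof. by rewrite !mxE; congr (A _ _); exact/val_inj. Qed.

Lemma dlsubmx0 m (A : 'M[R]_(1 + m)) k :
  dlsubmx A k ord0 = A (lift ord0 k) ord0.
Proof. by rewrite !mxE; congr (A _ _); exact/val_inj. Qed.

(** Induction on the dimension by one step of Gaussian elimination: a matrix with
nonzero pivot a is a block lower triangular matrix with diagonal (a, 1) times a
block upper triangular one with diagonal (1, B), where B is its Schur
complement.  A zero pivot is first repaired by adding another row to the first
one, which is again a block upper triangular map. *)
Theorem leb_affine m (A : 'M[R]_m) (b : 'rV[R]_m) : A \in unitmx ->
  scales_leb `|\det A| (fun x => b + x *m A).
Proof.
elim: m A b => [|m IH] A b Aunit.
  move=> S mS; rewrite det_mx00 normr1 mul1e; congr (leb 0 _).
  by apply/seteqP; split => x /=; rewrite [b + _]thinmx0 [x]thinmx0.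
have pivot (A' : 'M[R]_(1 + m)) b' : A' \in unitmx -> A' ord0 ord0 != 0 ->
    scales_leb `|\det A'| (fun x => b' + x *m A').
  move=> A'unit a0; set a := A' ord0 ord0 in a0.
  (* A' = [a 0; c 1] [1 r; 0 B] with the Schur complement B *)
  pose r := a^-1 *: ursubmx A'; pose c := dlsubmx A'.
  pose B := drsubmx A' - c *m r.
  have A'E : A' = block_mx a%:M 0 c 1%:M *m block_mx 1%:M r 0 B.
    rewrite mulmx_block !mulmx0 !mulmx1 !mul1mx !mul0mx !addr0.
    rewrite /B addrC subrK mul_scalar_mx scalerA divff// scale1r.
    rewrite -[LHS]submxK; congr block_mx; apply/rowP => i.
    by rewrite !ord1 !mxE eqxx mulr1n; congr (A' _ _); exact/val_inj.
  have detE : \det A' = a * \det B.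
    by rewrite A'E det_mulmx det_lblock det_ublock !det1 det_scalar1 mul1r mulr1.
  have Bunit : B \in unitmx.
    by move: A'unit; rewrite !unitmxE detE unitrM => /andP[].
  pose b0 := lsubmx b' ord0 ord0.
  (* the translation is shared out between the two factors: the first one
     produces b0 in front, which the shear by r carries to the tail *)
  have -> : (fun x => b' + x *m A') =
      (fun x => row_mx 0 (rsubmx b' - b0 *: r) + x *m block_mx 1%:M r 0 B) \o
      (fun x => row_mx b0%:M 0 + x *m block_mx a%:M 0 c 1%:M).
    apply/funext => x /=; rewrite mulmxDl -mulmxA -A'E addrA; congr (_ + _).
    rewrite mul_row_block !mul0mx !mulmx1 !addr0 mul_scalar_mx add_row_mx add0r.
    rewrite subrK -[LHS]hsubmxK; congr row_mx; apply/rowP => i.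
    by rewrite !ord1 [RHS]mxE eqxx mulr1n.
  rewrite detE normrM mulrC; apply: scales_leb_comp.
  - exact: measurable_affine_rV.
  - exact: scales_leb_lower.
  - by apply: scales_leb_upper => b''; exact: IH.
have [a0|a0] := eqVneq ((A : 'M[R]_(1 + m)) ord0 ord0) 0; last exact: pivot.
have [k ck0] : exists k, dlsubmx (A : 'M[R]_(1 + m)) k ord0 != 0.
  apply/existsP; apply: contraT; rewrite negb_exists => /forallP c0.
  have /matrixP/(_ ord0 ord0) := mulVmx Aunit; rewrite !mxE big_ord_recl a0.
  rewrite mulr0 add0r big1 => [/eqP|j _]; first by rewrite eq_sym oner_eq0.
  by have := c0 j; rewrite negbK dlsubmx0 => /eqP ->; rewrite mulr0.
pose A1 : 'M[R]_(1 + m) := A.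
pose r : 'rV[R]_m := delta_mx ord0 k.
pose A' : 'M[R]_(1 + m) := block_mx 1%:M r 0 1%:M *m (A : 'M[R]_(1 + m)).
have A'0 : A' ord0 ord0 != 0.
  rewrite -ulsubmx00.
  rewrite (_ : A' = block_mx 1%:M r 0 1%:M *m block_mx (ulsubmx A1)
    (ursubmx A1) (dlsubmx A1) (drsubmx A1)); last by rewrite submxK.
  rewrite mulmx_block block_mxKul mul1mx -rowE mxE.
  rewrite ulsubmx00 a0 add0r mxE.
  by [].
have detA' : \det A' = \det A.
  by rewrite det_mulmx det_ublock !det1 !mul1r.
have AE : A = block_mx 1%:M (- r) 0 1%:M *m A'.
  rewrite mulmxA mulmx_block !mulmx0 !mul0mx !mulmx1 !mul1mx !addr0 add0r.
  by rewrite subrr -scalar_mx_block mul1mx.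
have -> : (fun x : 'rV_m.+1 => b + x *m A) =
    (fun x => b + x *m A') \o
    (fun x : 'rV_(1 + m) => row_mx 0 0 + x *m block_mx 1%:M (- r) 0 1%:M).
  by apply/funext => x /=; rewrite row_mx0 add0r -mulmxA -AE.
rewrite -detA' -[X in scales_leb X _]mulr1; apply: scales_leb_comp.
- exact: measurable_affine_rV.
- have := @scales_leb_upper m 0 (- r) 1%:M (fun b' => IH 1%:M b' (unitmx1 R m)).
  by rewrite det1 normr1.
- apply: pivot => //; rewrite unitmxE detA' -unitmxE//.
Qed.


End ChangeOfVariables.

(** * Sizes of balls, compact sets, hyperplanes and affine images *)

Section Sizes.
Context {R : realType}.

Lemma dotvE d (x w : 'rV[R]_d) : dotv x w = (x *m w^T) ord0 ord0.
Proof. by rewrite mxE; apply: eq_bigr => i _; rewrite mxE. Qed.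

(** The norm on row vectors is the sup norm: balls are cubes. *)
Lemma leb_ball d (a : 'rV[R]_d) (r : R) : 0 < r ->
  leb d (ball a r) = ((r *+ 2) ^+ d)%:E.
Proof.
move=> r0; elim: d a => [|d IH] a.
  rewrite expr0 /= diracE mem_set//.
  by split => // i j; case: j.
pose a' : 'rV[R]_d := \row_i a ord0 (lift ord0 i).
transitivity ((@lebesgue_measure R \x leb d) (ball (a ord0 ord0) r `*` ball a' r))%E.
  congr (product_measure1 _ _ _); apply/seteqP.
  split => [[t x] /= [_ ab]|[t x] [/= tb [_ xb]]]; split.
  - by have := ab ord0 ord0; rewrite mxE unlift_none.
  - by split => // i j; have := ab i (lift ord0 j); rewrite !mxE liftK/= !ord1.
  - exact: r0.
  - move=> i j; rewrite ord1 mxE; case: (unliftP ord0 j) => [k ->|->] //=.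
    by have := xb ord0 k; rewrite mxE.
rewrite product_measure1E//; last 2 first.
- exact: measurable_ball.
- by apply: open_measurable_rV; exact: ball_open.
rewrite IH exprS EFinM; congr (_ * _)%E.
exact: (lebesgue_measure_ball _ (ltW r0)).
Qed.

Lemma compact_leb_lty d (D : set 'rV[R]_d) : compact D -> (leb d D < +oo)%E.
Proof.
move=> cD; have mD := compact_measurable_rV cD.
have [M [Mreal MD]] := @compact_bounded _ 'rV[R]_d _ cD.
pose r := `|M| + 2.
have r0 : 0 < r by rewrite /r ltr_wpDl.
apply: (@le_lt_trans _ _ (leb d (ball (0 : 'rV[R]_d) r))); last first.
  by rewrite leb_ball// ltry.
apply: le_measure; rewrite ?inE//.
  by apply: open_measurable_rV; exact: ball_open.
move=> x Dx; rewrite -ball_normE/= sub0r normrN.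
apply: le_lt_trans (MD (`|M| + 1) _ x Dx) _; last by rewrite ltrD2l ltr1n.
by rewrite (le_lt_trans (ler_norm _))// ltrDl.
Qed.

Lemma interior_leb_gt0 d (D : set 'rV[R]_d) : measurable D -> D° !=set0 ->
  (0 < leb d D)%E.
Proof.
move=> mD [x /nbhs_ballP[r /= r0 rD]].
apply: (@lt_le_trans _ _ (leb d (ball x r))).
  by rewrite leb_ball// lte_fin exprn_gt0// mulrn_wgt0.
apply: le_measure; rewrite ?inE//.
by apply: open_measurable_rV; exact: ball_open.
Qed.

Definition hyperplane d (w : 'rV[R]_d) (c : R) : set 'rV[R]_d :=
  [set x | dotv x w = c].

Lemma measurable_hyperplane d (w : 'rV[R]_d) c : measurable (hyperplane w c).
Proof.
have mf : measurable_fun setT (fun x : 'rV[R]_d => dotv x w).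
  apply: measurable_sum => i; apply: measurable_funM => //; exact: measurable_coor.
rewrite (_ : hyperplane w c = (fun x => dotv x w) @^-1` [set c]) //.
by rewrite -[X in measurable X]setTI; exact: mf.
Qed.

(** If w has a nonzero entry besides the first one, all slices at fixed first
coordinate are hyperplanes of one dimension less; otherwise the hyperplane fixes
the first coordinate. *)
Lemma leb_hyperplane d (w : 'rV[R]_d) c : w != 0 -> leb d (hyperplane w c) = 0%E.
Proof.
elim: d w c => [|d IH] w c w0; first by rewrite [w]thinmx0 eqxx in w0.
pose w' : 'rV[R]_d := \row_i w ord0 (lift ord0 i).
have dotE t x : dotv (consrV (t, x)) w = t * w ord0 ord0 + dotv x w'.
  rewrite /dotv big_ord_recl mxE unlift_none/=; congr (_ + _).
  by apply: eq_bigr => i _; rewrite !mxE liftK.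
have [w'0|w'0] := eqVneq w' 0; last first.
  rewrite leb_slice_head; apply: integral0_eq => t _.
  rewrite -(IH w' (c - t * w ord0 ord0) w'0); congr (leb d _).
  apply/seteqP; split => x; rewrite /hyperplane /= dotE.
    by move=> <-; rewrite addrC addKr.
  by move=> ->; rewrite addrC subrK.
have w00 : w ord0 ord0 != 0.
  apply: contraNneq w0 => w00; apply/eqP/rowP => i; rewrite mxE.
  case: (unliftP ord0 i) => [j ->|-> //].
  by move/rowP : w'0 => /(_ j); rewrite !mxE.
rewrite leb_slice_tail; last exact: measurable_hyperplane.
apply: integral0_eq => x _.
rewrite -(lebesgue_measure_set1 (c / w ord0 ord0)); congr lebesgue_measure.
apply/seteqP; split => t; rewrite /hyperplane /= dotE w'0 /dotv big1 ?addr0.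
- by move=> <-; rewrite mulfK.
- by move=> i _; rewrite mxE mulr0.
- by move=> ->; rewrite divfK.
- by move=> i _; rewrite mxE mulr0.
Qed.

Lemma affine_sub_hyperplane k m (b : 'rV[R]_m) (A : 'M[R]_(k, m)) :
  (\rank A < m)%N -> exists2 w, w != 0 &
  forall y : 'rV[R]_k, hyperplane w (dotv b w) (b + y *m A).
Proof.
move=> rA; have : kermx A^T != 0.
  by rewrite -mxrank_eq0 mxrank_ker mxrank_tr -lt0n subn_gt0.
rewrite -nz_row_eq0; exists (nz_row (kermx A^T)) => // y.
have /sub_kermxP wA := nz_row_sub (kermx A^T).
have Aw : A *m (nz_row (kermx A^T))^T = 0.
  by apply: trmx_inj; rewrite trmx_mul trmxK wA trmx0.
by rewrite /hyperplane/= !dotvE mulmxDl -mulmxA Aw mulmx0 addr0.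
Qed.

Lemma compact_affine_image k m (b : 'rV[R]_m) (A : 'M[R]_(k, m))
    (D : set 'rV[R]_k) :
  compact D -> compact ((fun y => b + y *m A) @` D).
Proof.
apply: continuous_compact; apply: continuous_subspaceT.
exact: continuous_affine_rV.
Qed.

(** A singular A maps everything into a hyperplane, in agreement with
\det A = 0. *)
Lemma leb_affine_image m (b : 'rV[R]_m) (A : 'M[R]_m) (D : set 'rV[R]_m) :
  compact D ->
  leb m ((fun y => b + y *m A) @` D) = (`|\det A|%:E * leb m D)%E.
Proof.
move=> cD.
have mI := compact_measurable_rV (compact_affine_image (b := b) (A := A) cD).
have [Aunit|AN] := boolP (A \in unitmx).
  rewrite (leb_affine b Aunit mI); congr (_ * leb m _)%E.
  apply/seteqP; split => [y [z Dz]|y Dy]; last by exists y.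
  by move/addrI/(can_inj (mulmxK Aunit)) => <-.
have [w w0 wP] : exists2 w, w != 0 &
    forall y : 'rV[R]_m, hyperplane w (dotv b w) (b + y *m A).
  by apply: affine_sub_hyperplane; rewrite ltn_neqAle rank_leq_col andbT
     -[_ == _]/(row_free A) row_free_unit.
rewrite (_ : \det A = 0) ?normr0 ?mul0e; last first.
  by apply/eqP; move: AN; rewrite unitmxE unitfE negbK.
apply/eqP; rewrite eq_le measure_ge0 andbT -(leb_hyperplane (dotv b w) w0).
apply: le_measure; rewrite ?inE//; first exact: measurable_hyperplane.
by move=> _ [y _ <-]; exact: wP.
Qed.

End Sizes.

(** * Dot products and projections along a coordinate axis *)

Section DotProduct.
Context {R : realType} {d : nat}.
Implicit Types u v w : 'rV[R]_d.

Lemma dotvC u v : dotv u v = dotv v u.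
Proof. by apply: eq_bigr => i _; rewrite mulrC. Qed.

Lemma dotvDl u v w : dotv (u + v) w = dotv u w + dotv v w.
Proof. by rewrite /dotv -big_split; apply: eq_bigr => i _; rewrite mxE mulrDl. Qed.

Lemma dotvZl (a : R) u w : dotv (a *: u) w = a * dotv u w.
Proof. by rewrite /dotv mulr_sumr; apply: eq_bigr => i _; rewrite mxE mulrA. Qed.

Lemma dotvNl u w : dotv (- u) w = - dotv u w.
Proof. by rewrite -scaleN1r dotvZl mulN1r. Qed.

Lemma dotvBl u v w : dotv (u - v) w = dotv u w - dotv v w.
Proof. by rewrite dotvDl dotvNl. Qed.

Lemma dotvDr u v w : dotv w (u + v) = dotv w u + dotv w v.
Proof. by rewrite ![dotv w _]dotvC dotvDl. Qed.

Lemma dotvZr (a : R) u w : dotv w (a *: u) = a * dotv w u.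
Proof. by rewrite ![dotv w _]dotvC dotvZl. Qed.

Lemma dotvNr u w : dotv w (- u) = - dotv w u.
Proof. by rewrite ![dotv w _]dotvC dotvNl. Qed.

Lemma dotvBr u v w : dotv w (u - v) = dotv w u - dotv w v.
Proof. by rewrite ![dotv w _]dotvC dotvBl. Qed.

Lemma dotv0l w : dotv 0 w = 0.
Proof. by rewrite -(scale0r 0) dotvZl mul0r. Qed.

Lemma dotv_suml (I : Type) (r : seq I) (P : pred I) (F : I -> 'rV[R]_d) w :
  dotv (\sum_(i <- r | P i) F i) w = \sum_(i <- r | P i) dotv (F i) w.
Proof.
by elim/big_rec2: _ => [|i x y _ <-]; [rewrite dotv0l|rewrite dotvDl].
Qed.

Lemma dotv_ge0 u : 0 <= dotv u u.
Proof. by apply: sumr_ge0 => i _; exact: sqr_ge0. Qed.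

Lemma dotv_eq0 u : (dotv u u == 0) = (u == 0).
Proof.
apply/idP/eqP => [|->]; last by rewrite dotv0l.
rewrite psumr_eq0 => [/allP u0|i _]; last exact: sqr_ge0.
apply/rowP => i; rewrite mxE; apply/eqP; rewrite -[_ == _]orbb -mulf_eq0.
by apply: u0; rewrite mem_index_enum.
Qed.

Lemma dotv_delta i w : dotv (delta_mx ord0 i) w = w ord0 i.
Proof.
rewrite /dotv (bigD1 i)//= big1 => [|j ji]; rewrite !mxE !eqxx/= ?mul1r ?addr0//.
by rewrite (negbTE ji) mul0r.
Qed.

End DotProduct.

Section ProjectedFrame.
Context {R : realType} {m : nat}.

Lemma col'D k (i : 'I_m.+1) (A B : 'M[R]_(k, m.+1)) :
  col' i (A + B) = col' i A + col' i B.
Proof. by apply/matrixP => a b; rewrite !mxE. Qed.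

Lemma col'M k l (i : 'I_m.+1) (A : 'M[R]_(l, k)) (B : 'M[R]_(k, m.+1)) :
  col' i (A *m B) = A *m col' i B.
Proof.
by apply/matrixP => a b; rewrite !mxE; apply: eq_bigr => j _; rewrite !mxE.
Qed.

(** Stacking n on top of F gives an orthogonal matrix Q, whose adjugate is
therefore det Q times Q^T; the minors omitting the row n are thus, up to sign,
the entries of n. *)
Lemma det_projected_frame (F : 'M[R]_(m, m.+1)) (n : 'rV[R]_m.+1) i :
  F *m F^T = 1%:M -> F *m n^T = 0 -> dotv n n = 1 ->
  `|\det (col' i F)| = `|n ord0 i|.
Proof.
move=> FF Fn nn; pose Q : 'M[R]_(1 + m) := col_mx n F.
have QQ : Q *m Q^T = 1%:M.
  rewrite tr_col_mx mul_col_row FF Fn (_ : n *m F^T = 0); last first.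
    by apply: trmx_inj; rewrite trmx_mul trmxK Fn trmx0.
  rewrite (_ : n *m n^T = 1%:M) -?scalar_mx_block//.
  by apply/matrixP => a b; rewrite !ord1 -dotvE nn mxE.
have adjQ : \adj Q = \det Q *: Q^T.
  have QTQ := mulmx1C QQ.
  by rewrite -[LHS]mul1mx -QTQ -mulmxA mul_mx_adj mul_mx_scalar.
have detQ : `|\det Q| = 1.
  have : \det Q * \det Q = 1 by rewrite -[X in _ * X]det_tr -det_mulmx QQ det1.
  by move=> dd; apply/eqP; rewrite -(@pexpr_eq1 _ _ 2)// expr2 -normrM dd normr1.
move/matrixP: adjQ => /(_ i ord0); rewrite mxE [RHS]mxE mxE.
rewrite (_ : Q ord0 i = n ord0 i); last first.
  by rewrite mxE; case: splitP => // j _; rewrite ord1.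
move=> /(congr1 Num.norm); rewrite [RHS]normrM detQ mul1r => <-.
rewrite /cofactor normrM normrX normrN1 expr1n mul1r; congr `|\det _|.
apply/matrixP => a b; rewrite !mxE; case: splitP => j //=.
  by rewrite ord1.
by move=> /= [aj]; congr (F _ _); apply/val_inj.
Qed.

(** |n_i| is the cosine of the angle between the hyperplane of the cell and the
coordinate hyperplane orthogonal to e_i. *)
Lemma leb_projected_cell k (F : 'M[R]_(k, m.+1)) (b n : 'rV[R]_m.+1) i
    (D : set 'rV[R]_k) :
  k.+1 = m.+1 -> F *m F^T = 1%:M -> F *m n^T = 0 -> dotv n n = 1 -> compact D ->
  leb m ((fun y => col' i (b + y *m F)) @` D) = (`|n ord0 i|%:E * leb k D)%E.
Proof.
move=> km; have {km} mk : m = k by case: km.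
move: F D; rewrite -mk => F D FF Fn nn cD.
rewrite -(det_projected_frame i FF Fn nn).
rewrite -(leb_affine_image (col' i b) (col' i F) cD); congr (leb m _).
by apply: eq_imagel => y _; rewrite col'D col'M.
Qed.

(** The edges of the faces have codimension 2, so their projections are
negligible. *)
Lemma projected_low_dim_hyperplane k (F : 'M[R]_(k, m.+1)) (b : 'rV[R]_m.+1) i :
  (k < m)%N -> exists w c, w != 0 /\
  forall y : 'rV[R]_k, hyperplane w c (col' i (b + y *m F)).
Proof.
move=> km; have [] := @affine_sub_hyperplane R k m (col' i b) (col' i F).
  exact: leq_ltn_trans (rank_leq_row _) km.
by move=> w w0 wP; exists w, (dotv (col' i b) w); split => // y; rewrite col'D col'M.
Qed.

End ProjectedFrame.

(** * Sides of a face *)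

Section Crossing.
Context {R : realType}.

(** The set where f equals f x is relatively open by local constancy, and so is
its complement. *)
Lemma locally_constant_connected (T : topologicalType) (U : Type) (A : set T)
    (f : T -> U) : connected A ->
  (forall x, A x -> \forall y \near x, f y = f x) ->
  forall x y, A x -> A y -> f x = f y.
Proof.
move=> cA loc x y Ax Ay.
pose B : set T := [set z | \forall w \near z, f w = f x].
pose C : set T := [set z | \forall w \near z, f w <> f x].
have AB z : A z -> f z = f x -> B z.
  by move=> Az zx; apply: filterS (loc z Az) => w ->.
have AC z : A z -> f z <> f x -> C z.
  by move=> Az zx; apply: filterS (loc z Az) => w ->.
have AB' : A `&` B = A.
  apply: cA; first by exists x; split => //; exact: AB.
  - by exists B => //; exact: open_interior.
  - exists (~` C); first by apply: open_closedC; exact: open_interior.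
    apply/seteqP; split => z [Az].
      move=> /nbhs_singleton Bz; split => // /nbhs_singleton; exact.
    move=> nC; split => //; apply: contrapT => zB; apply: nC.
    by apply: AC => // zx; apply: zB; exact: AB.
by have /nbhs_singleton -> : B y by move: Ay; rewrite -AB' => -[].
Qed.

Lemma segment_avoids_boundary d (K : set 'rV[R]_d) (y z : 'rV[R]_d) :
  closed K ->
  (forall a : R, 0 <= a <= 1 -> ~ (K `\` K°) (y + a *: (z - y))) ->
  K y -> K z.
Proof.
move=> cK avoid Ky.
pose l a := y + a *: (z - y).
have cl : continuous l.
  move=> a; apply: cvgD; first exact: cvg_cst.
  by apply: cvgZ; [exact: cvg_id|exact: cvg_cst].
have := @locally_constant_connected R Prop `[0, 1]%classic (fun a : R => K (l a)).
move=> /(_ (@segment_connected R 0 1)) h.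
have -> : K z = K (l 1) by rewrite /l scale1r addrC subrK.
rewrite -(h _ 0 1) //= ?in_itv/= ?lexx ?ler01//.
  by rewrite /l scale0r addr0.
move=> a; rewrite in_itv/= => /avoid na.
have [Ka|Ka] := pselect (K (l a)).
  have Kao : nbhs (l a) K by apply: contrapT => h'; exact: na.
  have : \forall b \near a, K (l b) by exact: cl a K Kao.
  by apply: (@filterS _ (nbhs a)) => b Kb; apply/propext; split.
have : nbhs (l a) (~` K) by apply: open_nbhs_nbhs; split => //; exact: closed_openC.
move=> /(cl a) h'; have : \forall b \near a, ~ K (l b) by exact: h'.
by apply: (@filterS _ (nbhs a)) => b Kb; apply/propext; split.
Qed.

(** The mesh axioms describe the two sides of a face in the normal direction
only.  Away from the other faces, a small ball minus the hyperplane of the face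
misses the boundary of K, and its halves are convex; so each half lies entirely
inside or entirely outside K, and any transversal direction sees the same sides
as the normal. *)
Lemma outward_direction d (K : set 'rV[R]_d) (S : finType) (E : {set S})
    (sigma : S -> set 'rV[R]_d) (s : S) (n v x : 'rV[R]_d) (c : R) :
  closed K -> K `\` K° = \bigcup_(r in [set` E]) sigma r ->
  (forall r, r \in E -> closed (sigma r)) ->
  sigma s `<=` hyperplane n c -> sigma s x ->
  (forall r, r \in E -> r != s -> ~ sigma r x) ->
  (\forall t \near 0^'+, K (x - t *: n) /\ ~ K (x + t *: n)) ->
  0 < dotv n n -> 0 < dotv v n ->
  \forall t \near 0^'+, K (x - t *: v) /\ ~ K (x + t *: v).
Proof.
move=> cK bdK csig sH sx others out nn vn.
have : \forall w \near x, forall r, r \in E -> r != s -> ~ sigma r w.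
  apply: (@filter_forall _ _ _ (nbhs x)) => r.
  have [/andP[rE rs]|rNE] := boolP ((r \in E) && (r != s)); last first.
    by apply: nearW => w rE rs; move: rNE; rewrite rE rs.
  have : nbhs x (~` sigma r).
    by apply: open_nbhs_nbhs; split; [exact/closed_openC/csig|exact: others].
  by apply: (@filterS _ (nbhs x)) => w nw _ _.
move=> /nbhs_ballP[e /= e0 eW].
(* the segment between the points x + tau w0 and x + tau w1 stays in one half
   of the ball *)
have side (tau : R) (w0 w1 : 'rV[R]_d) : tau != 0 ->
    0 < dotv w0 n -> 0 < dotv w1 n -> `|tau *: w0| < e -> `|tau *: w1| < e ->
    K (x + tau *: w0) -> K (x + tau *: w1).
  move=> tau0 w0n w1n w0e w1e; apply: segment_avoids_boundary => // a /andP[a0 a1].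
  pose w := (1 - a) *: w0 + a *: w1.
  have -> : x + tau *: w0 + a *: (x + tau *: w1 - (x + tau *: w0)) = x + tau *: w.
    rewrite opprD addrACA subrr add0r -scalerBr -addrA; congr (x + _).
    rewrite scalerA mulrC -scalerA -scalerDr; congr (tau *: _).
    by rewrite /w scalerBr scalerBl scale1r addrA addrAC.
  have wn : 0 < dotv w n.
    rewrite dotvDl !dotvZl; have [->|aN0] := eqVneq a 0.
      by rewrite subr0 mul1r mul0r addr0.
    rewrite ltr_wpDl// ?mulr_ge0 ?subr_ge0 ?(ltW w0n)//.
    by rewrite mulr_gt0// lt_neqAle eq_sym aN0.
  have we : `|tau *: w| < e.
    rewrite scalerDr !scalerA ![tau * _]mulrC -!scalerA.
    apply: le_lt_trans (ler_normD _ _) _; rewrite !normrZ (ger0_norm a0).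
    rewrite (@ger0_norm _ (1 - a)) ?subr_ge0//.
    move: w0e w1e; rewrite !normrZ.
    move: (`|tau| * `|w0|) (`|tau| * `|w1|) => A B Ae Be.
    have [AB|/ltW BA] := leP A B.
      apply: le_lt_trans Be; rewrite -subr_ge0.
      by rewrite [leRHS](_ : _ = (1 - a) * (B - A)) ?mulr_ge0 ?subr_ge0//; ring.
    apply: le_lt_trans Ae; rewrite -subr_ge0.
    by rewrite [leRHS](_ : _ = a * (A - B)) ?mulr_ge0 ?subr_ge0//; ring.
  rewrite bdK => -[r /= rE]; have [->|rs] := eqVneq r s; last first.
    by apply: eW; rewrite // -ball_normE/= opprD addNKr normrN.
  move=> /sH; rewrite /hyperplane/= dotvDl (sH _ sx) dotvZl => /eqP.
  by rewrite -[X in _ == X]addr0 (inj_eq (addrI _)) mulf_eq0 (negbTE tau0) gt_eqF.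
have small (w : 'rV[R]_d) : \forall t \near 0^'+, `|t *: w| < e.
  have : (fun t : R => t *: w) t @[t --> 0^'+] --> 0 *: w.
    apply: cvgZ; last exact: cvg_cst.
    exact: cvg_at_right_filter (@cvg_id _ _).
  rewrite scale0r => /cvgrPdist_lt /(_ _ e0); apply: filterS => t.
  by rewrite sub0r normrN.
near=> t.
have t0 : 0 < t by near: t; exact: nbhs_right_gt.
have tn : `|t *: n| < e by near: t; exact: small.
have tv : `|t *: v| < e by near: t; exact: small.
have [Kin Kout] : K (x - t *: n) /\ ~ K (x + t *: n) by near: t.
split.
  rewrite -scaleNr; apply: (side _ n v); rewrite ?oppr_eq0 ?gt_eqF//.
  - by rewrite scaleNr normrN.
  - by rewrite scaleNr normrN.
  - by rewrite scaleNr.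
by move=> Kv; apply: Kout; apply: (side _ v n); rewrite ?gt_eqF.
Unshelve. all: by end_near. Qed.

End Crossing.

(** * Crossings of a line with the boundary *)

Section Line.
Context {R : realType}.

Lemma near_ltr (h t : R) : h != t -> \forall b \near t, (h < b) = (h < t).
Proof.
move=> ht; have [lt|] := ltP h t.
  by apply: filterS (lt_nbhsr lt) => b.
rewrite le_eqVlt eq_sym (negbTE ht)/= => gt.
by apply: filterS (lt_nbhsl gt) => b bh; apply/negbTE; rewrite -leNgt ltW.
Qed.

Lemma near_ler (h t : R) : h != t -> \forall b \near t, (h <= b) = (h <= t).
Proof.
move=> ht; have [|gt] := leP h t; last first.
  by apply: filterS (lt_nbhsl gt) => b bh; apply/negbTE; rewrite -ltNge.
rewrite le_eqVlt (negbTE ht)/= => lt.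
by apply: filterS (lt_nbhsr lt) => b /ltW.
Qed.

(** Along the line, let G(t) be the indicator of K plus a step function for each
crossing, +1 from an exit on and -1 from an entrance on.  The steps compensate
the jumps of the indicator, so G is locally constant, hence constant; far out
on both sides the indicator vanishes, and comparing the two ends shows that the
steps add up to 0. *)
Lemma line_crossings d (K : set 'rV[R]_d) (S : finType) (E : {set S})
    (sigma : S -> set 'rV[R]_d) (n : S -> 'rV[R]_d) (c : S -> R)
    (p v : 'rV[R]_d) :
  v != 0 -> compact K -> K `\` K° = \bigcup_(r in [set` E]) sigma r ->
  (forall s, s \in E -> closed (sigma s)) ->
  (forall s, s \in E -> sigma s `<=` hyperplane (n s) (c s)) ->
  (forall s, s \in E -> dotv (n s) (n s) = 1) ->
  (forall s t, s \in E -> sigma s (p + t *: v) -> [/\ dotv v (n s) != 0,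
     forall r, r \in E -> r != s -> ~ sigma r (p + t *: v) &
     \forall e \near 0^'+, K (p + t *: v - e *: n s) /\
                           ~ K (p + t *: v + e *: n s)]) ->
  \sum_(s in E | `[< exists t, sigma s (p + t *: v) >]) Num.sg (dotv v (n s)) = 0.
Proof.
move=> v0 cK bdK csig sH nn cross.
have clK : closed K by apply: compact_closed cK; exact: (@norm_hausdorff _ 'rV[R]_d).
have [T T0 KT] : exists2 T : R, 0 < T & forall t, K (p + t *: v) -> `|t| < T.
  have [M [Mreal MK]] := @compact_bounded _ 'rV[R]_d _ cK.
  have vgt0 : 0 < `|v| by rewrite normr_gt0.
  exists ((`|M| + 1 + `|p| + 1) / `|v|).
    by rewrite divr_gt0// !ltr_wpDl ?addr_ge0.
  move=> t /(MK (`|M| + 1)); rewrite ltr_pdivlMr// -normrZ.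
  have -> : M < `|M| + 1 by rewrite (le_lt_trans (ler_norm _))// ltrDl.
  move=> /(_ isT) Mt; have := ler_normB (p + t *: v) p; rewrite addrAC subrr add0r.
  move=> /le_lt_trans; apply; rewrite -!addrA.
  apply: le_lt_trans (lerD Mt (lexx _)) _; rewrite -!addrA ltrD2l ltrD2l.
  by rewrite ltrDl.
pose hit s := `[< exists t, sigma s (p + t *: v) >].
pose h s := (c s - dotv p (n s)) / dotv v (n s).
have hE s t : s \in E -> sigma s (p + t *: v) -> t = h s.
  move=> sE st; have [vn _ _] := cross _ _ sE st.
  move: (sH _ sE _ st); rewrite /hyperplane/= dotvDl dotvZl /h => <-.
  by rewrite addrC addKr mulfK.
have hitP s : s \in E -> hit s -> sigma s (p + h s *: v).
  by move=> sE /asboolP[t st]; rewrite -(hE s t).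
have sK s x : s \in E -> sigma s x -> (K `\` K°) x.
  by move=> sE sx; rewrite bdK; exists s.
(* K is closed, so its indicator is 1 at a crossing: a step must be taken just
   after an exit (strict inequality) but already at an entrance *)
pose jumpf s (t : R) : R :=
  if 0 < dotv v (n s) then (h s < t)%R%:R else - (h s <= t)%R%:R.
pose G (t : R) : R := `[< K (p + t *: v) >]%:R + \sum_(s in E | hit s) jumpf s t.
have jumpf_loc s t : h s != t -> \forall b \near t, jumpf s b = jumpf s t.
  move=> hst; rewrite /jumpf; case: ifP => _.
    by apply: filterS (near_ltr hst) => b ->.
  by apply: filterS (near_ler hst) => b ->.
have cl : continuous (fun t : R => p + t *: v).
  move=> a; apply: cvgD; first exact: cvg_cst.
  by apply: cvgZ; [exact: cvg_id|exact: cvg_cst].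
have Gloc t : \forall b \near t, G b = G t.
  have [[s [sE st]]|nobd] := pselect (exists s, s \in E /\ sigma s (p + t *: v)).
    have [vn others out] := cross _ _ sE st.
    have hs := hE _ _ sE st.
    have hits : hit s by apply/asboolP; exists t.
    have rest : \forall b \near t, forall r, r \in E -> hit r -> r != s ->
        jumpf r b = jumpf r t.
      apply: (@filter_forall _ _ _ (nbhs t)) => r.
      have [/and3P[rE hitr rs]|rN] := boolP [&& r \in E, hit r & r != s]; last first.
        by apply: nearW => b rE hitr rs; move: rN; rewrite rE hitr rs.
      have : h r != t.
        by apply/eqP => hrt; apply: (others r) => //; rewrite -hrt; exact: hitP.
      by move=> /jumpf_loc; apply: (@filterS _ (nbhs t)) => b jb _ _ _.
    have main : \forall b \near t, `[< K (p + b *: v) >]%:R + jumpf s b =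
        `[< K (p + t *: v) >]%:R + jumpf s t :> R.
      have Kt : K (p + t *: v) by have [] := sK _ _ sE st.
      have right_ball (P : R -> Prop) : (\forall e \near 0^'+, P e) ->
          \forall b \near t, (t < b -> P (b - t)) /\ (b < t -> P (t - b)).
        move=> /nbhs_ballP[e /= e0 eP].
        apply: (@filterS _ (nbhs t)) (nbhsx_ballx t _ e0).
        move=> b; rewrite -ball_normE/= => tb; split => bt; apply: eP => /=.
        - by rewrite -ball_normE/= sub0r opprB.
        - by rewrite subr_gt0.
        - by rewrite -ball_normE/= sub0r normrN.
        - by rewrite subr_gt0.
      have shift_line b : p + b *: v = p + t *: v + (b - t) *: v.
        by rewrite -addrA -scalerDl [t + _]addrC subrK.
      have out' w : 0 < dotv w (n s) -> \forall e \near 0^'+,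
          K (p + t *: v - e *: w) /\ ~ K (p + t *: v + e *: w).
        apply: (outward_direction clK bdK csig (sH s sE) st others out).
        by rewrite nn.
      have [vn_gt0|] := ltP 0 (dotv v (n s)).
        have := right_ball _ (out' v vn_gt0).
        apply: (@filterS _ (nbhs t)) => b [gtb ltb].
        rewrite /jumpf vn_gt0 -hs ltxx (asboolT Kt) addr0.
        have [bt|tb|->] := ltgtP b t.
        - rewrite asboolT ?addr0//; rewrite shift_line.
          by have [] := ltb bt; rewrite -scaleNr opprB.
        - rewrite asboolF ?add0r//; rewrite shift_line.
          by have [] := gtb tb.
        - by rewrite asboolT ?addr0.
      rewrite le_eqVlt (negbTE vn)/= => vn_lt0.
      have Nvn_gt0 : 0 < dotv (- v) (n s) by rewrite dotvNl oppr_gt0.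
      have := right_ball _ (out' (- v) Nvn_gt0).
      apply: (@filterS _ (nbhs t)) => b [gtb ltb].
      rewrite /jumpf ltNge (ltW vn_lt0)/= -hs lexx (asboolT Kt) subrr.
      have [bt|tb|->] := ltgtP b t.
      - rewrite asboolF ?add0r ?oppr0//; rewrite shift_line.
        by have [_] := ltb bt; rewrite scalerN -scaleNr opprB.
      - rewrite asboolT ?subrr//; rewrite shift_line.
        by have [] := gtb tb; rewrite scalerN opprK.
      - by rewrite asboolT ?subrr.
    apply: (@filterS2 _ (nbhs t)) rest main => b restb mainb.
    rewrite /G (bigD1 s) ?sE//= [in RHS](bigD1 s) ?sE//= !addrA mainb; congr (_ + _).
    by apply: eq_bigr => r /andP[/andP[rE hitr] rs]; exact: restb.
  have rest : \forall b \near t, forall r, r \in E -> hit r ->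
      jumpf r b = jumpf r t.
    apply: (@filter_forall _ _ _ (nbhs t)) => r.
    have [/andP[rE hitr]|rN] := boolP ((r \in E) && hit r); last first.
      by apply: nearW => b rE hitr; move: rN; rewrite rE hitr.
    have : h r != t.
      apply/eqP => hrt; apply: nobd; exists r; rewrite -hrt; split => //.
      exact: hitP.
    by move=> /jumpf_loc; apply: (@filterS _ (nbhs t)) => b jb _ _.
  have main : \forall b \near t,
      `[< K (p + b *: v) >] = `[< K (p + t *: v) >].
    have [Kt|Kt] := pselect (K (p + t *: v)).
      have Kao : nbhs (p + t *: v) K.
        apply: contrapT => h'; apply: nobd.
        have : (K `\` K°) (p + t *: v) by split.
        by rewrite bdK => -[s /= sE ss]; exists s.
      have : \forall b \near t, K (p + b *: v) by exact: cl t K Kao.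
      by apply: (@filterS _ (nbhs t)) => b Kb; rewrite !asboolT.
    have : nbhs (p + t *: v) (~` K).
      by apply: open_nbhs_nbhs; split => //; exact: closed_openC.
    move=> /(cl t) h'; have : \forall b \near t, ~ K (p + b *: v) by exact: h'.
    by apply: (@filterS _ (nbhs t)) => b Kb; rewrite !asboolF.
  apply: (@filterS2 _ (nbhs t)) rest main => b restb mainb.
  rewrite /G mainb; congr (_ + _).
  by apply: eq_bigr => r /andP[rE hitr]; exact: restb.
have GT : G (- T) = G T.
  apply: (@locally_constant_connected R R setT) => //.
  by apply/connected_intervalP => x y _ _ z _.
have nK t : T <= `|t| -> ~ K (p + t *: v).
  by move=> Tt /KT; rewrite ltNge Tt.
have hT s : s \in E -> hit s -> `|h s| < T.
  by move=> sE hits; apply: KT; have [] := sK _ _ sE (hitP _ sE hits).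
move: GT; rewrite /G !asboolF; try by apply: nK; rewrite ?normrN ger0_norm// ltW.
rewrite !add0r big1 => [GT|s /andP[sE hits]]; last first.
  have := hT _ sE hits; rewrite ltr_norml => /andP[hl _].
  by rewrite /jumpf; case: ifP => _; [rewrite ltNge (ltW hl)|rewrite leNgt hl oppr0].
rewrite [RHS]GT; apply: eq_bigr => s /andP[sE hits].
have := hT _ sE hits; rewrite ltr_norml => /andP[_ hr].
rewrite /jumpf hr (ltW hr); have [vn _ _] := cross _ _ sE (hitP _ sE hits).
by case: ltP => [/gtr0_sg//|]; rewrite le_eqVlt (negbTE vn)/= => /ltr0_sg.
Qed.

End Line.

(** * The area vectors of an element add up to zero *)

Section SumIndic.
Context {R : realType} d (T : measurableType d) (mu : {measure set T -> \bar R}).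
Variables (S : finType) (A : S -> set T).
Hypothesis mA : forall s, measurable (A s).

Lemma measurable_sum_indic (P : pred S) :
  measurable_fun setT (fun x => (\sum_(s | P s) (\1_(A s) x)%:E)%E : \bar R).
Proof.
under eq_fun do rewrite -big_filter.
apply: emeasurable_sum => s; apply/measurable_EFinP.
exact: measurable_indic.
Qed.

Lemma integral_sum_indic (P : pred S) :
  (\int[mu]_x (\sum_(s | P s) (\1_(A s) x)%:E) = \sum_(s | P s) mu (A s))%E.
Proof.
under eq_integral do rewrite -big_filter.
rewrite ge0_integral_sum//; last first.
  by move=> s; apply/measurable_EFinP; exact: measurable_indic.
by rewrite big_filter; apply: eq_bigr => s _; rewrite integral_indic// setIT.
Qed.

Lemma sum_measure_ae_eq (P Q : pred S) :
  {ae mu, forall x, \sum_(s | P s) \1_(A s) x = \sum_(s | Q s) \1_(A s) x :> R} ->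
  (\sum_(s | P s) mu (A s) = \sum_(s | Q s) mu (A s))%E.
Proof.
move=> PQ; rewrite -!integral_sum_indic.
apply: ge0_ae_eq_integral => //; try exact: measurable_sum_indic.
- by move=> x _; apply: sume_ge0 => s _; rewrite lee_fin.
- by move=> x _; apply: sume_ge0 => s _; rewrite lee_fin.
by apply: filterS PQ => x /= PQx _; rewrite !sumEFin PQx.
Qed.

End SumIndic.

Section Closedness.
Context {R : realType} {m : nat}.
Variable M : mesh (R := R) m.+1.
Implicit Types (K : elt M) (s r : subcell M).

Local Notation dom s := (@cell_dom R m.+1 (cell_of s)).

Let origin K s := cell_base (cell_of s) + latticeV (elt_shift K s).
Let face K s := translate (elt_shift K s) (cell_set (cell_of s)).

Lemma faceE K s : face K s =
  (fun y => origin K s + y *m cell_frame (cell_of s)) @` dom s.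
Proof.
apply/seteqP; split => x.
  by move=> [_ [y Dy <-] <-]; exists y => //; rewrite /origin /cell_chart addrAC.
move=> [y Dy <-]; exists (cell_chart y); first by exists y.
by rewrite /origin /cell_chart addrAC.
Qed.

Lemma compact_face K s : compact (face K s).
Proof.
by rewrite faceE; apply: compact_affine_image; have [] := cell_dom_solid (cell_of s).
Qed.

Lemma face_sub_hyperplane K s : s \in elt_faces K ->
  face K s `<=` hyperplane (face_normal s K) (dotv (origin K s) (face_normal s K)).
Proof.
move=> sK x; rewrite faceE => -[y _ <-].
by rewrite /hyperplane/= dotvDl [X in _ + X]dotvE -mulmxA face_normal_orthogonal//
  mulmx0 mxE addr0.
Qed.

Variable i : 'I_m.+1.

Let proj K s : set 'rV[R]_m := col' i @` face K s.

Lemma projE K s : proj K s =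
  (fun y => col' i (origin K s + y *m cell_frame (cell_of s))) @`
    dom s.
Proof.
rewrite /proj faceE; apply/seteqP; split => x.
  by move=> [_ [y Dy <-] <-]; exists y.
by move=> [y Dy <-]; eexists; first by exists y; [exact: Dy|reflexivity].
Qed.

Lemma measurable_proj K s : measurable (proj K s).
Proof.
apply: compact_measurable_rV; rewrite projE.
rewrite (_ : (fun y => _) = fun y =>
    col' i (origin K s) + y *m col' i (cell_frame (cell_of s))).
  by apply: compact_affine_image; have [] := cell_dom_solid (cell_of s).
by apply/funext => y; rewrite col'D col'M.
Qed.

Lemma leb_proj K s : s \in elt_faces K ->
  leb m (proj K s) = (`|face_normal s K ord0 i| * area s)%:E.
Proof.
move=> sK; have [cD _ _ _] := cell_dom_solid (cell_of s).
rewrite projE (@leb_projected_cell _ _ _ _ _ (face_normal s K))//.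
- rewrite EFinM /area /cell_measure fineK// ge0_fin_numE ?measure_ge0//.
  exact: compact_leb_lty.
- exact: elt_faces_dim sK.
- exact: cell_frame_orthonormal.
- exact: face_normal_orthogonal.
- exact: face_normal_unit.
Qed.

(** The points x of the coordinate hyperplane for which the line over x
meets every face of K transversally and in its relative interior. *)
Definition generic K (x : 'rV[R]_m) := forall s, s \in elt_faces K ->
  (face_normal s K ord0 i = 0 -> ~ proj K s x) /\
  (forall c, c \in cell_faces s -> ~ (col' i @`
     translate (elt_shift K s)
       (translate (cell_shift s c) (cell_set (cell_of c)))) x).

Lemma ae_generic K : {ae leb m, forall x, generic K x}.
Proof.
apply: filter_forall => s.
have [sK|sNK] := boolP (s \in elt_faces K); last first.
  by apply: aeW.
suff : \forall x \near almost_everywhere (leb m),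
   (face_normal s K ord0 i = 0 -> ~ proj K s x) /\
  (forall c, c \in cell_faces s -> ~ (col' i @`
     translate (elt_shift K s)
       (translate (cell_shift s c) (cell_set (cell_of c)))) x).
  by apply: filterS => x h _.
apply: filterI.
  have [ni0|niN0] := eqVneq (face_normal s K ord0 i) 0; last first.
    by apply: aeW => x ni0; rewrite ni0 eqxx in niN0.
  exists (proj K s); split; first exact: measurable_proj.
    by rewrite leb_proj// ni0 normr0 mul0r.
  by move=> x /= h; apply: contrapT => nx; apply: h.
apply: (@filter_forall _ _ _ (almost_everywhere (leb m))) => c.
have [cs|cNs] := boolP (c \in cell_faces s); last first.
  by apply: aeW.
have km : (cell_dim (cell_of c) < m)%N.
  by rewrite (cell_faces_dim cs) -ltnS (elt_faces_dim sK).
have [w [a [w0 wP]]] := projected_low_dim_hyperplane (cell_frame (cell_of c))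
  (cell_base (cell_of c) + latticeV (cell_shift s c) + latticeV (elt_shift K s)) i km.
exists (hyperplane w a); split; first exact: measurable_hyperplane.
  exact: leb_hyperplane.
move=> x /= h; suff : (col' i @` translate (elt_shift K s)
  (translate (cell_shift s c) (cell_set (cell_of c)))) x.
  move=> [_ [_ [_ [y _ <-] <-] <-] <-].
  by rewrite /cell_chart 2!(addrAC _ (_ *m _)); exact: wP.
by apply: contrapT => nx; apply: h.
Qed.

(** Over a generic x the line crosses each face at most once and no two faces at
the same point, which is the setting of [line_crossings]. *)
Lemma sum_sg_generic K x : generic K x ->
  \sum_(s in elt_faces K | x \in proj K s) Num.sg (face_normal s K ord0 i) = 0.
Proof.
move=> gx; pose v : 'rV[R]_m.+1 := delta_mx ord0 i.
pose p : 'rV[R]_m.+1 := \row_j oapp (x ord0) 0 (unlift i j).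
have colp t : col' i (p + t *: v) = x.
  apply/rowP => j; rewrite !mxE liftK/= eq_sym (negbTE (neq_lift i j)) mulr0.
  by rewrite addr0.
have linep z : col' i z = x -> z = p + z ord0 i *: v.
  move=> zx; apply/rowP => j; rewrite !mxE/=.
  case: (unliftP i j) => [k ->|->]/=.
    rewrite eq_sym (negbTE (neq_lift i k)) mulr0 addr0.
    by move/rowP: zx => /(_ k); rewrite mxE.
  by rewrite eqxx mulr1 add0r.
have hitE s : s \in elt_faces K ->
    (x \in proj K s) = `[< exists t, face K s (p + t *: v) >].
  move=> sK; apply/idP/asboolP => [|[t st]].
    by rewrite inE => -[z zs zx]; exists (z ord0 i); rewrite -linep.
  by rewrite inE; exists (p + t *: v).
have bdx s t : s \in elt_faces K -> face K s (p + t *: v) ->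
    translate (elt_shift K s) (cell_relint (cell_of s)) (p + t *: v).
  move=> sK st; have [_ gs] := gx _ sK.
  move: (st) => [_ [y Dy <-] ye].
  have [Dyo|nDyo] := pselect ((dom s)° y).
    by exists (cell_chart y) => //; exists y.
  have : cell_relbd (cell_of s) (cell_chart y) by exists y.
  rewrite cell_boundary => -[c /= cs yc]; exfalso; apply: (gs c cs).
  by exists (p + t *: v) => //; exists (cell_chart y).
have [cK _ _ _] := @elt_set_solid _ _ M K.
rewrite (eq_bigl (fun s => (s \in elt_faces K) &&
    `[< exists t, face K s (p + t *: v) >])); last first.
  by move=> s; case: (boolP (s \in _)) => //= sK; rewrite hitE.
under eq_bigr do rewrite -dotv_delta.
apply: (@line_crossings R _ (elt_set K) _ (elt_faces K) (face K)
  (fun s => face_normal s K) (fun s => dotv (origin K s) (face_normal s K)) p v).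
- by apply/eqP => /matrixP/(_ ord0 i); rewrite !mxE !eqxx => /eqP; rewrite oner_eq0.
- exact: cK.
- exact: elt_set_boundary.
- move=> s _; have cs := @compact_face K s; apply: compact_closed cs.
  exact: (@norm_hausdorff _ 'rV[R]_m.+1).
- by move=> s; exact: face_sub_hyperplane.
- by move=> s; exact: face_normal_unit.
move=> s t sK st; split.
- rewrite dotv_delta; apply/eqP => ni0; have [gs _] := gx _ sK.
  by apply: gs => //; exists (p + t *: v).
- move=> r rK rs rt.
  have := elt_faces_disjoint rK sK rs.
  by move/seteqP => [/(_ (p + t *: v)) h _]; apply: h; split; exact: bdx.
- by apply: face_normal_outward => //; exact: bdx.
Qed.

Lemma sum_area_normal_coord K :
  \sum_(s in elt_faces K) area s * face_normal s K ord0 i = 0.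
Proof.
pose n s : R := face_normal s K ord0 i.
have : (\sum_(s | (s \in elt_faces K) && (0 < n s)%R) leb m (proj K s) =
  \sum_(s | (s \in elt_faces K) && (n s < 0)%R) leb m (proj K s))%E.
  apply: sum_measure_ae_eq; first by move=> s; exact: measurable_proj.
  apply: filterS (ae_generic K) => x /sum_sg_generic.
  rewrite big_mkcondr/= => /eqP.
  rewrite (eq_bigr (fun s => (0 < n s)%R%:R * \1_(proj K s) x -
      (n s < 0)%R%:R * \1_(proj K s) x)); last first.
    move=> s _; rewrite indicE; case: ifP => _; rewrite ?mulr0 ?subrr// !mulr1.
    by rewrite -/(n s); case: (sgrP (n s)); rewrite ?subrr ?subr0 ?sub0r.
  rewrite sumrB subr_eq0 => /eqP E; rewrite !big_mkcondr/=.
  have F (b : bool) (a : R) : (if b then a else 0) = b%:R * a.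
    by case: b; rewrite ?mul1r ?mul0r.
  by under eq_bigr do rewrite F; under [in RHS]eq_bigr do rewrite F.
rewrite (eq_bigr (fun s => (area s * n s)%:E)); last first.
  by move=> s /andP[sK ns]; rewrite leb_proj// gtr0_norm// mulrC.
rewrite [in RHS](eq_bigr (fun s => (- (area s * n s))%:E)); last first.
  by move=> s /andP[sK ns]; rewrite leb_proj// ltr0_norm// mulNr mulrC.
rewrite !sumEFin => -[]; rewrite sumrN => /eqP; rewrite -addr_eq0 => /eqP E.
rewrite (bigID (fun s => 0 < n s))/= -[RHS]E; congr (_ + _).
rewrite (bigID (fun s => n s < 0))/= addrC big1 ?add0r => [|s].
  apply: eq_bigl => s; rewrite -andbA; congr (_ && _).
  by case: (ltgtP (n s) 0) => // [/ltW|->]; rewrite ?leNgt ?ltxx// => ->.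
case/andP=> /andP[_]; rewrite -!leNgt => n_le0 n_ge0.
by rewrite -/(n s) (_ : n s = 0) ?mulr0//; apply/eqP; rewrite eq_le n_le0 n_ge0.
Qed.

End Closedness.

(** The divergence theorem for constant vector fields on a mesh element. *)
Theorem sum_area_normal (R : realType) d (M : mesh (R := R) d) (K : elt M) :
  (0 < d)%N -> \sum_(s in elt_faces K) area s *: face_normal s K = 0.
Proof.
case: d M K => // m M K _; apply/rowP => i.
rewrite mxE summxE -[RHS](sum_area_normal_coord i K).
by apply: eq_bigr => s _; rewrite mxE.
Qed.

(** * The pressure potential *)

Section Potential.
Context {R : realType} (kappa gamma : R).
Hypotheses (kappa_gt0 : 0 < kappa) (gamma_gt1 : 1 < gamma).
Local Notation P := (potential kappa gamma).
Local Notation P' := (derive1 (potential kappa gamma)).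
Local Notation p := (pressure kappa gamma).

Lemma is_derive_potential (r : R) : 0 < r ->
  is_derive r 1 P (kappa * gamma / (gamma - 1) * r `^ (gamma - 1)).
Proof.
move=> r0.
have h := @is_derive1_powR R gamma r r0.
rewrite (_ : P = (fun x : R => (kappa / (gamma - 1)) *: x `^ gamma)); last first.
  by apply/funext => x; rewrite /potential -[RHS]/(_ * _); ring.
apply: is_derive_eq; rewrite -[LHS]/(_ * _); ring.
Qed.

Lemma derive1_potential (r : R) : 0 < r ->
  P' r = kappa * gamma / (gamma - 1) * r `^ (gamma - 1).
Proof. by move=> r0; rewrite derive1E; have [_ ->] := is_derive_potential r0. Qed.

(** The relation p = rho P' - P is what links the pressure gradient to the
transport of the internal energy. *)
Lemma derive1_potential_pressure (r : R) : 0 < r -> P' r * r - P r = p r.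
Proof.
move=> r0; rewrite derive1_potential// /potential /pressure.
rewrite -(mulr_powRB1 (ltW r0) (lt_trans ltr01 gamma_gt1)).
by field; rewrite subr_eq0 gt_eqF.
Qed.

Lemma lt_derive1_potential (a b : R) : 0 < a -> a < b -> P' a < P' b.
Proof.
move=> a0 ab; have b0 := lt_trans a0 ab; rewrite !derive1_potential//.
rewrite ltr_pM2l; first by rewrite gt0_ltr_powR// ?subr_gt0// nnegrE ltW.
by rewrite divr_gt0 ?subr_gt0// mulr_gt0// (lt_trans ltr01).
Qed.

Lemma potential_convex (a b : R) : 0 < a -> 0 < b -> P a - P b <= P' a * (a - b).
Proof.
move=> a0 b0.
have cP (x y : R) : 0 < x -> {within `[x, y], continuous P}.
  move=> x0; apply: derivable_within_continuous => z; rewrite in_itv/= => /andP[xz _].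
  by have [] := is_derive_potential (lt_le_trans x0 xz).
have dP (x y : R) : 0 < x -> forall z, z \in `]x, y[ -> is_derive z 1 P (P' z).
  move=> x0 z; rewrite in_itv/= => /andP[xz _]; have z0 := lt_trans x0 xz.
  by rewrite derive1_potential//; exact: is_derive_potential.
have [ab|ba|->] := ltgtP a b; last by rewrite !subrr mulr0.
  have [c] := MVT ab (dP a b a0) (cP a b a0); rewrite in_itv/= => /andP[ac cb] E.
  have := lt_derive1_potential a0 ac; have : P a - P b = P' c * (a - b) by lra.
  by move=> -> /ltW h; apply: ler_wnM2r h; rewrite subr_le0 ltW.
have [c] := MVT ba (dP b a b0) (cP b a b0); rewrite in_itv/= => /andP[bc ca] ->.
have := lt_derive1_potential (lt_trans b0 bc) ca.
by move=> /ltW h; apply: ler_wpM2r h; rewrite subr_ge0 ltW.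
Qed.

End Potential.

(** * Pairing the two sides of the faces *)

Section Neighbours.
Context {R : realType} {d : nat} (M : mesh (R := R) d).
Implicit Types (K L : elt M) (s : subcell M).

Lemma nbrP s K : s \in elt_faces K -> [/\ nbr s K != K, s \in elt_faces (nbr s K),
  nbr s (nbr s K) = K & face_normal s (nbr s K) = - face_normal s K].
Proof.
move=> sK; have := face_shared (elt_faces_dim sK).
move=> /eqP/cards2P[A [B [AB EAB]]].
have sE J : (s \in elt_faces J) = (J == A) || (J == B).
  by move/setP : EAB => /(_ J); rewrite !inE.
have nbrE J J' : s \in elt_faces J -> s \in elt_faces J' -> J != J' -> nbr s J = J'.
  move=> sJ sJ' JJ'; rewrite /nbr.
  case: pickP => [L /= /andP[LJ sL]|/(_ J')]/=; last first.
    by rewrite eq_sym JJ' sJ'.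
  move: sJ sJ' sL JJ' LJ; rewrite !sE.
  by move=> /orP[]/eqP-> /orP[]/eqP-> /orP[]/eqP->; rewrite ?eqxx.
have [L sL LK] : exists2 L, s \in elt_faces L & L != K.
  move: sK; rewrite sE => /orP[] /eqP ->.
    by exists B; rewrite ?sE ?eqxx ?orbT// eq_sym.
  by exists A; rewrite ?sE ?eqxx.
have KL : K != L by rewrite eq_sym.
rewrite (nbrE K L)//; split => //; first exact: nbrE.
exact: face_normal_opp.
Qed.

(** The neighbour across s is a fixed-point-free involution of the two elements
that have s as a face, so the inner sums can be reindexed by it. *)
Lemma sum_nbr (f : subcell M -> elt M -> R) :
  \sum_K \sum_(s in elt_faces K) f s (nbr s K) =
  \sum_K \sum_(s in elt_faces K) f s K.
Proof.
under eq_bigr do rewrite big_mkcond; under [RHS]eq_bigr do rewrite big_mkcond.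
rewrite exchange_big [RHS]exchange_big/=; apply: eq_bigr => s _.
rewrite -!big_mkcond/= [RHS](reindex_onto (nbr s) (nbr s))/=; last first.
  by move=> K /nbrP[].
apply: eq_bigl => K.
apply/idP/idP => [/nbrP[_ sN NN _]|/andP[/nbrP[_ + _ _] /eqP E]].
  by rewrite sN NN eqxx.
by rewrite E.
Qed.

Lemma sum_faces_le0 (f : subcell M -> elt M -> R) :
  (forall s K, s \in elt_faces K -> f s K + f s (nbr s K) <= 0) ->
  \sum_K \sum_(s in elt_faces K) f s K <= 0.
Proof.
move=> f0; set S := (X in X <= 0).
have : S + S <= 0; last by lra.
rewrite /S -{2}sum_nbr -big_split/=; apply: sumr_le0 => K _.
by rewrite -big_split/=; apply: sumr_le0 => s; exact: f0.
Qed.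

(** Needed because the discrete divergence and gradient divide by |K|. *)
Lemma vol_gt0 K : 0 < vol K.
Proof.
have [cK _ iK _] := elt_set_solid K.
rewrite /vol fine_gt0// interior_leb_gt0//=; last exact: compact_measurable_rV.
exact: compact_leb_lty.
Qed.

Lemma area_ge0 s : 0 <= area s.
Proof. exact/fine_ge0/measure_ge0. Qed.

Lemma jump_nbr (V : zmodType) (phi : elt M -> V) s K : s \in elt_faces K ->
  jump phi s (nbr s K) = - jump phi s K.
Proof. by move=> /nbrP[_ _ NN _]; rewrite /jump NN opprB. Qed.

Lemma mean_nbr (V : lmodType R) (phi : elt M -> V) s K : s \in elt_faces K ->
  mean phi s (nbr s K) = mean phi s K.
Proof. by move=> /nbrP[_ _ NN _]; rewrite /mean NN addrC. Qed.

End Neighbours.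

(** * Dissipation on one face *)

Section FaceDissipation.
Context {R : realType}.

(** Here a, b are the densities and u, w the velocities on the two sides, N is
the mass flux and q the convective momentum flux.  The numerical diffusion
combines, thanks to the identity
[u].[rho u] - [|u|^2/2][rho] = {rho} |[u]|^2, to a multiple of |[u]|^2. *)
Lemma convective_face_dissipation d (lam a b N : R) (u w q : 'rV[R]_d) :
  0 < a -> 0 < b ->
  (w - u != 0 -> (- N * (dotv w w / 2 - dotv u u / 2) + dotv (w - u) q)
     / ((a + b) / 2 * dotv (w - u) (w - u)) <= lam) ->
  dotv (w - u) q - N * (dotv w w / 2 - dotv u u / 2)
    - lam * (dotv (w - u) (b *: w - a *: u)
             - (dotv w w / 2 - dotv u u / 2) * (b - a)) <= 0.
Proof.
move=> a0 b0 hlam.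
have -> : dotv (w - u) (b *: w - a *: u) - (dotv w w / 2 - dotv u u / 2) * (b - a)
    = (a + b) / 2 * dotv (w - u) (w - u).
  by rewrite !dotvBr !dotvZr !dotvBl (dotvC u w); field.
have [wu|wu] := eqVneq (w - u) 0.
  have -> : w = u by apply/eqP; rewrite -subr_eq0 wu.
  by rewrite !subrr !dotv0l !mulr0 !subrr.
have D0 : 0 < (a + b) / 2 * dotv (w - u) (w - u).
  rewrite mulr_gt0//; first by rewrite divr_gt0// addr_gt0.
  by rewrite lt_neqAle dotv_ge0 eq_sym dotv_eq0 wu.
move: (hlam wu); rewrite ler_pdivrMr// => h; lra.
Qed.

(** Here x, y are the normal velocities, Pa, da, pa the values of P, P', p on the
side with density a, and Qa, Qb the values of P'' at the intermediate points.
Expanding p = rho P' - P turns the first three terms into half the difference of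
the second order Taylor remainders of P weighted by y and x, which are
Qb (b - a)^2/2 and Qa (b - a)^2/2. *)
Lemma pressure_face_dissipation (lam a b x y Pa Pb da db pa pb Qa Qb : R) :
  da * a - Pa = pa -> db * b - Pb = pb ->
  (b - a = 0 -> Pa = Pb /\ da = db) ->
  (b - a != 0 -> 0 < (db - da) * (b - a)) ->
  (b - a != 0 -> Qb * (2^-1 * (b - a) ^+ 2) = Pb - Pa - da * (b - a)) ->
  (b - a != 0 -> Qa * (2^-1 * (b - a) ^+ 2) = Pa - Pb - db * (a - b)) ->
  (b - a != 0 ->
     (b - a) ^+ 2 * (Qb * y - Qa * x) / (4 * (db - da) * (b - a)) <= lam) ->
  (pa + pb) / 2 * (y - x) + (db - da) * ((a * x + b * y) / 2)
    + (pa * x - pb * y) - lam * ((db - da) * (b - a)) <= 0.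
Proof.
move=> <- <- eq0 pos hQb hQa hlam.
have [ab|ab] := eqVneq (b - a) 0.
  have [-> ->] := eq0 ab; have -> : b = a by apply/eqP; rewrite -subr_eq0 ab.
  by rewrite le_eqVlt; apply/orP; left; apply/eqP; field.
have D0 : 0 < 4 * (db - da) * (b - a) by have := pos ab; lra.
move: (hlam ab); rewrite ler_pdivrMr// => h.
have -> : (da * a - Pa + (db * b - Pb)) / 2 * (y - x)
    + (db - da) * ((a * x + b * y) / 2) + ((da * a - Pa) * x - (db * b - Pb) * y)
  = 2^-1 * ((Pb - Pa - da * (b - a)) * y - (Pa - Pb - db * (a - b)) * x) by field.
rewrite -(hQb ab) -(hQa ab); lra.
Qed.

End FaceDissipation.

(** * One time step *)

Section Step.
Context {R : realType} {d : nat} (M : mesh (R := R) d).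
Implicit Types (K L : elt M) (s : subcell M).
Variables (kappa gamma eps : R).
Hypotheses (kappa_gt0 : 0 < kappa) (gamma_gt1 : 1 < gamma) (eps_gt0 : 0 < eps).
Variables (dt : R) (rho rho1 : elt M -> R) (u u1 : elt M -> 'rV[R]_d).
Variables (lam : subcell M -> R) (rs : subcell M -> elt M -> R).
Hypotheses (dt_gt0 : 0 < dt).
Hypotheses (rho_gt0 : forall K, 0 < rho K) (rho1_gt0 : forall K, 0 < rho1 K).
Hypothesis rs_int : intermediate_values kappa gamma rs rho1.
Hypothesis lam_cond : lam_condition kappa gamma rs lam rho u rho1 u1.
Hypothesis mass : mass_equation dt lam rho rho1 u1.
Hypothesis mom : momentum_equation kappa gamma eps dt lam rho u rho1 u1.

Local Notation P := (potential kappa gamma).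
Local Notation P' := (derive1 (potential kappa gamma)).
Local Notation p := (pressure kappa gamma).
Local Notation flux s K :=
  (tensor_apply (mean (momentum_flux rho u) s K) (face_normal s K)).
Local Notation mflux s K :=
  (dotv (mean (momentum rho1 u1) s K) (face_normal s K)).

Let ieps := (eps ^+ 2)^-1.

(** The contribution of the face s of K, per unit area and time, to the tested
equations.  The last term adds the flux of p u seen from inside K alone: it
completes the face terms to a dissipation, and its sum over the faces of K is 0
since the area vectors add up to 0. *)
Definition face_work s K : R :=
  - dotv (u1 K) (flux s K) + lam s * dotv (u1 K) (jump (momentum rho1 u1) s K)
  - ieps * (meanR (p \o rho1) s K * dotv (u1 K) (face_normal s K))
  + (kinetic u1 K - ieps * P' (rho1 K)) * (mflux s K - lam s * jump rho1 s K)
  + ieps * (p (rho1 K) * dotv (u1 K) (face_normal s K)).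

Lemma face_work_le0 s K : s \in elt_faces K ->
  face_work s K + face_work s (nbr s K) <= 0.
Proof.
move=> sK; have [LK sL NN nL] := nbrP sK.
set L := nbr s K in LK sL NN nL *; set n := face_normal s K in nL *.
pose q := flux s K; pose N := mflux s K.
have lamE := lam_cond sK.
have rhoM : meanR rho1 s K = (rho1 K + rho1 L) / 2 by rewrite mulrC.
have conv : dotv (u1 L - u1 K) q - N * jump (kinetic u1) s K
    - lam s * (dotv (u1 L - u1 K) (jump (momentum rho1 u1) s K)
               - jump (kinetic u1) s K * jump rho1 s K) <= 0.
  apply: convective_face_dissipation => // wu.
  have : lam_convection rho u rho1 u1 s K <= lam s by rewrite lamE le_max lexx orbT.
  by rewrite /lam_convection ifN// rhoM.
have NE : N = (rho1 K * dotv (u1 K) n + rho1 L * dotv (u1 L) n) / 2.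
  by rewrite /N dotvZl dotvDl !dotvZl mulrC.
have pM : meanR (p \o rho1) s K = (p (rho1 K) + p (rho1 L)) / 2 by rewrite mulrC.
have pres : (p (rho1 K) + p (rho1 L)) / 2 * (dotv (u1 L) n - dotv (u1 K) n)
    + jump (P' \o rho1) s K * ((rho1 K * dotv (u1 K) n + rho1 L * dotv (u1 L) n) / 2)
    + (p (rho1 K) * dotv (u1 K) n - p (rho1 L) * dotv (u1 L) n)
    - lam s * (jump (P' \o rho1) s K * jump rho1 s K) <= 0.
  apply: (@pressure_face_dissipation _ _ _ _ _ _ (P (rho1 K)) (P (rho1 L)) _ _ _ _
    (derive1n 2 P (rs s K)) (derive1n 2 P (rs s L))).
  - exact: derive1_potential_pressure.
  - exact: derive1_potential_pressure.
  - by move=> /subr0_eq E; rewrite /= -/L E; split.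
  - rewrite /jump subr_eq0 -/L /= => ab.
    have mono := lt_derive1_potential kappa_gt0 gamma_gt1.
    have [lab|lba|E] := ltgtP (rho1 K) (rho1 L).
    + by apply: mulr_gt0; rewrite subr_gt0//; exact: mono.
    + by rewrite nmulr_rgt0 subr_lt0//; exact: mono.
    + by rewrite E eqxx in ab.
  - by move=> ab; have [_ ->] := rs_int sK ab.
  - move=> ab; have jL : jump rho1 s L = rho1 K - rho1 L by rewrite /jump NN.
    have ba : jump rho1 s L != 0 by rewrite jL subr_eq0 eq_sym -subr_eq0.
    have [_ ] := rs_int sL ba; rewrite /jump/= NN -/L => <-.
    by congr (_ * _); ring.
  - move=> ab; have : lam_pressure kappa gamma rs rho1 u1 s K <= lam s.
      by rewrite lamE le_max lexx.
    by rewrite /lam_pressure ifN// dotvBl !dotvZl.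
have -> : face_work s K + face_work s L =
  (dotv (u1 L - u1 K) q - N * jump (kinetic u1) s K
    - lam s * (dotv (u1 L - u1 K) (jump (momentum rho1 u1) s K)
               - jump (kinetic u1) s K * jump rho1 s K)) +
  ieps * ((p (rho1 K) + p (rho1 L)) / 2 * (dotv (u1 L) n - dotv (u1 K) n)
    + jump (P' \o rho1) s K * ((rho1 K * dotv (u1 K) n + rho1 L * dotv (u1 L) n) / 2)
    + (p (rho1 K) * dotv (u1 K) n - p (rho1 L) * dotv (u1 L) n)
    - lam s * (jump (P' \o rho1) s K * jump rho1 s K)).
  rewrite /face_work !(jump_nbr _ sK) !(mean_nbr _ sK) nL -/n.
  rewrite /meanR !(mean_nbr _ sK) -!/(meanR _ _ _) pM -NE.
  have -> : tensor_apply (mean (momentum_flux rho u) s K) (- n) = - q.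
    by rewrite /tensor_apply mulNmx.
  rewrite -/q -/N !dotvNr dotvBl !dotvBl /= /jump/= -/L.
  rewrite -[dotv (mean _ _ _) n]/N.
  move: (momentum _ _ L - _) => J; move: (dotv (u1 K) J) (dotv (u1 L) J) => xJ yJ.
  move: (dotv (u1 K) n) (dotv (u1 L) n) (dotv (u1 K) q) (dotv (u1 L) q) (N).
  move=> x y xq yq N0.
  move: (kinetic u1 K) (kinetic u1 L) (P' (rho1 K)) (P' (rho1 L)) => kx ky da db.
  move: (p (rho1 K)) (p (rho1 L)) (rho1 L - rho1 K) (lam s) (ieps) => pa pb r l e.
  by ring.
have ieps_ge0 : 0 <= ieps by rewrite invr_ge0 exprn_ge0// ltW.
rewrite -[leRHS]addr0; apply: lerD conv _.
exact: mulr_ge0_le0 ieps_ge0 pres.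
Qed.

Hypothesis closed_elts : forall K,
  \sum_(s in elt_faces K) area s *: face_normal s K = 0.

Lemma mass_balance K : vol K * (rho1 K - rho K) =
  - dt * \sum_(s in elt_faces K) area s * (mflux s K - lam s * jump rho1 s K).
Proof.
have v0 : vol K != 0 by rewrite gt_eqF ?vol_gt0.
have := mass K; rewrite /divh -addrA -sumrB => /eqP.
rewrite addr_eq0 => /eqP E.
have -> : rho1 K - rho K = dt * ((rho1 K - rho K) / dt).
  by rewrite mulrC divfK ?gt_eqF.
rewrite E mulrCA !mulrN mulNr; congr (- (_ * _)); rewrite mulr_sumr.
by apply: eq_bigr => s _; field.
Qed.

Lemma momentum_balance K w :
  vol K * dotv w (momentum rho1 u1 K - momentum rho u K) =
  - dt * \sum_(s in elt_faces K) area s *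
    (dotv w (flux s K) - lam s * dotv w (jump (momentum rho1 u1) s K)
     + ieps * (meanR (p \o rho1) s K * dotv w (face_normal s K))).
Proof.
have v0 : vol K != 0 by rewrite gt_eqF ?vol_gt0.
have := mom K; rewrite -!addrA => /eqP; rewrite addr_eq0 => /eqP E.
have -> : momentum rho1 u1 K - momentum rho u K =
    dt *: (dt^-1 *: (momentum rho1 u1 K - momentum rho u K)).
  by rewrite scalerA divff ?scale1r ?gt_eqF.
rewrite E dotvZr dotvNr mulrCA !mulrN mulNr; congr (- (_ * _)).
rewrite /divhT /gradh !dotvDr dotvNr dotvZr.
rewrite ![dotv w (\sum_(_ in _) _)]dotvC !dotv_suml.
rewrite !mulr_sumr -sumrN -!big_split/= mulr_sumr; apply: eq_bigr => s _.
by rewrite -/ieps !dotvZl ![dotv _ w]dotvC; field.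
Qed.

(** Up to the factor dt, the tested balance laws sum up to the total face work,
and the energy increment lies below by convexity of P and of |.|^2. *)
Lemma energy_step : energy kappa gamma eps rho1 u1 <= energy kappa gamma eps rho u.
Proof.
have ieps_ge0 : 0 <= ieps by rewrite invr_ge0 exprn_ge0// ltW.
rewrite -subr_le0 /energy -sumrB.
apply: (@le_trans _ _ (\sum_K dt * \sum_(s in elt_faces K) area s * face_work s K)).
  apply: ler_sum => K _.
  have -> : dt * \sum_(s in elt_faces K) area s * face_work s K =
      vol K * dotv (u1 K) (momentum rho1 u1 K - momentum rho u K)
      + (ieps * P' (rho1 K) - kinetic u1 K) * (vol K * (rho1 K - rho K)).
    rewrite mass_balance momentum_balance.
    have := congr1 (fun v => dotv v (u1 K)) (closed_elts K).
    rewrite dotv_suml dotv0l => cl.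
    rewrite (eq_bigr (fun s => area s *
       ((kinetic u1 K - ieps * P' (rho1 K)) * (mflux s K - lam s * jump rho1 s K))
       - area s * (dotv (u1 K) (flux s K)
         - lam s * dotv (u1 K) (jump (momentum rho1 u1) s K)
         + ieps * (meanR (p \o rho1) s K * dotv (u1 K) (face_normal s K)))
       + ieps * p (rho1 K) * dotv (area s *: face_normal s K) (u1 K))); last first.
      move=> s _; rewrite /face_work dotvZl [dotv (face_normal _ _) _]dotvC.
      move: (dotv (u1 K) (face_normal s K)) (mflux s K) (dotv (u1 K) (flux s K)).
      move: (dotv (u1 K) (jump _ s K)) (meanR _ s K) => *; ring.
    rewrite big_split sumrB/= -mulr_sumr cl mulr0 addr0.
    rewrite (eq_bigr (fun s => (kinetic u1 K - ieps * P' (rho1 K)) *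
      (area s * (mflux s K - lam s * jump rho1 s K)))); last first.
      by move=> s _; rewrite mulrCA.
    by rewrite -mulr_sumr; ring.
  rewrite -mulrBr (mulrCA (ieps * P' (rho1 K) - _)) -mulrDr.
  apply: ler_wpM2l; first exact/ltW/vol_gt0.
  have conv := potential_convex kappa_gt0 gamma_gt1 (rho1_gt0 K) (rho_gt0 K).
  have := ler_wpM2l ieps_ge0 conv => {}conv.
  (* the kinetic energy dissipated by the implicit time discretization *)
  have sq : 0 <= rho K * dotv (u1 K - u K) (u1 K - u K).
    by rewrite mulr_ge0 ?dotv_ge0// ltW.
  move: sq; rewrite /momentum !dotvBr !dotvZr !dotvBl (dotvC (u K) (u1 K)).
  rewrite /kinetic -/ieps.
  lra.
rewrite -mulr_sumr pmulr_rle0//; apply: sum_faces_le0 => s K sK.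
by rewrite -mulrDr mulr_ge0_le0 ?area_ge0 ?face_work_le0.
Qed.

End Step.

Theorem theorem3p2 (R : realType) (d : nat) (hd : (1 <= d <= 3)%N)
  (kappa gamma eps : R) (hkappa : 0 < kappa) (hgamma : 1 < gamma)
  (heps : 0 < eps)
  (M : mesh (R := R) d)
  (h theta : R) (hh : 0 < h) (htheta : 0 < theta)
  (hM : regular_quasi_uniform M h theta)
  (N : nat) (T : R) (t : nat -> R) (ht0 : t 0%N = 0) (htN : t N = T)
  (ht : forall n, (n < N)%N -> t n < t n.+1)
  (rho0 : 'rV[R]_d -> R) (u0 : 'rV[R]_d -> 'rV[R]_d)
  (hrho0_per : lattice_periodic rho0) (hu0_per : lattice_periodic u0)
  (hrho0_int : (leb d).-integrable (unit_cube d) (EFin \o rho0))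
  (hu0_int : forall i, (leb d).-integrable (unit_cube d)
     (EFin \o (fun x => u0 x ord0 i)))
  (hrho0_pos : forall x, 0 < rho0 x)
  (rho : nat -> elt M -> R) (u : nat -> elt M -> 'rV[R]_d)
  (lam : nat -> subcell M -> R) (rs : nat -> subcell M -> elt M -> R)
  (hrho_init : forall K, rho 0%N K = cell_average rho0 K)
  (hu_init : forall K, u 0%N K = cell_averageV u0 K)
  (hrho_pos : forall n K, (n <= N)%N -> 0 < rho n K)
  (hlam_ge0 : forall n s K, (n < N)%N -> s \in elt_faces K -> 0 <= lam n s)
  (hmass : forall n, (n < N)%N ->
     mass_equation (t n.+1 - t n) (lam n) (rho n) (rho n.+1) (u n.+1))
  (hmomentum : forall n, (n < N)%N ->
     momentum_equation kappa gamma eps (t n.+1 - t n) (lam n)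
       (rho n) (u n) (rho n.+1) (u n.+1))
  (hrs : forall n, (n < N)%N ->
     intermediate_values kappa gamma (rs n) (rho n.+1))
  (hlam : forall n, (n < N)%N ->
     lam_condition kappa gamma (rs n) (lam n)
       (rho n) (u n) (rho n.+1) (u n.+1)) :
  forall n, (n < N)%N ->
    energy kappa gamma eps (rho n.+1) (u n.+1)
    <= energy kappa gamma eps (rho n) (u n).
Proof.
move=> n nN.
have d_gt0 : (0 < d)%N by case/andP: hd.
have dt_gt0 : 0 < t n.+1 - t n by rewrite subr_gt0 ht.
apply: (energy_step hkappa hgamma heps dt_gt0 _ _ (hrs n nN) (hlam n nN)
  (hmass n nN) (hmomentum n nN)).
- by move=> K; apply: hrho_pos; exact: ltnW.
- by move=> K; exact: hrho_pos.
- by move=> K; exact: sum_area_normal.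
Qed.
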